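(* Let $E$ be a Banach space, let $F$ be an $\mathcal{L}_1$-space, let $Q:F\to E$ be a surjective bounded linear operator, and let $X_E=\ker Q$. Then the following conditions are equivalent: (+) $X_E$ is a GT-space; (++) every twisted sum of $\ell^2$ and $E$ splits; (+++) $\sup \mathrm{spl}(Y)<+\infty$, where the supremum extends over all positive integers $n$ and all twisted sums $Y$ of $\ell^2_n$ and $E$.
   Context: An $\mathcal{L}_1$-space is a Banach space $F$ for which there is $\sigma\in[1,\infty)$ such that every finite dimensional subspace of $F$ is contained in a finite dimensional subspace $F_\alpha$ of $F$ whose Banach–Mazur distance to $\ell^1_{\dim F_\alpha}$ is at most $\sigma$. A Banach space $X$ is a GT-space if every bounded linear operator from $X$ into $\ell^2$ is 1-absolutely summing (i.e. there is $K<\infty$ with $\sum_i\|u(x_i)\|\le K\sup\{\sum_i|x^*(x_i)|: x^*\in X^*,\|x^*\|\le 1\}$ for all finite sequences $(x_i)$ in $X$). $\ell^2_n$ is the $n$-dimensional Hilbert space. A quotient map is a bounded linear surjection $q:Y\to Z$ such that the induced map $Y/\ker q\to Z$ is an isometric isomorphism. A Banach space $Y$ is a twisted sum of Banach spaces $X$ and $Z$ (in this order) if there is a short exact sequence $0\to X\xrightarrow{j}Y\xrightarrow{q}Z\to 0$, i.e. $j(X)=\ker q$, with $j$ an isometric linear embedding and $q$ a quotient map; the sequence is part of the data. The twisted sum splits if there exists a bounded linear operator $v:Z\to Y$ with $qv=\mathrm{id}_Z$ (equivalently, there is a bounded linear projection from $Y$ onto $j(X)$). For a twisted sum $Y$ of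 $X$ and $Z$ put $\mathrm{spl}(Y)=+\infty$ if $Y$ does not split, and otherwise $\mathrm{spl}(Y)=\inf\,(\|v\|^2+\|\mathrm{id}_Y-vq\|^2)^{1/2}$, the infimum being over all bounded linear $v:Z\to Y$ with $qv=\mathrm{id}_Z$. *)

(* Defs.v *)
From HB Require Import structures.
From mathcomp Require Import all_boot all_order all_algebra.
From mathcomp Require Import all_classical all_reals all_analysis.
From mathcomp Require Import ring.

(* Banach spaces are real: completeNormedModType R with R : realType.         *)
(* A bounded linear operator is a {linear V -> W} together with a proof of    *)
(* continuity (see linear_bounded_continuous and linear_boundedP).            *)

Set Implicit Arguments.
Unset Strict Implicit.
Unset Printing Implicit Defensive.

Import Order.TTheory GRing.Theory Num.Theory.
Import numFieldNormedType.Exports.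

Local Open Scope classical_set_scope.
Local Open Scope ring_scope.

(* A linear subspace S of V as a normed space, with the norm of V.            *)
Record submod_type (R : realType) (V : normedModType R) (S : submodClosed V) :=
  SubmodElt { submod_val : V; submod_valP : submod_val \in S }.

Section SubmodType.
Variables (R : realType) (V : normedModType R) (S : submodClosed V).
Local Notation W := (submod_type S).

HB.instance Definition _ := [isSub for @submod_val R V S].
HB.instance Definition _ := [Choice of W by <:].
HB.instance Definition _ := [SubChoice_isSubLmodule of W by <:].

Definition submod_norm (x : W) : R := `|val x|.

Fact submod_normD x y : submod_norm (x + y) <= submod_norm x + submod_norm y.
Proof. by rewrite /submod_norm raddfD ler_normD. Qed.

Fact submod_normZ (l : R) x : submod_norm (l *: x) = `|l| * submod_norm x.
Proof. by rewrite /submod_norm linearZ normrZ. Qed.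

Fact submod_norm0_eq0 x : submod_norm x = 0 -> x = 0.
Proof. by move/normr0_eq0 => x0; apply: val_inj; rewrite x0 raddf0. Qed.

HB.instance Definition _ :=
  Lmodule_isNormed.Build R W submod_normD submod_normZ submod_norm0_eq0.
End SubmodType.

Section LinKer.
Variables (R : realType) (V W : normedModType R) (f : {linear V -> W}).
Definition linker : {pred V} := [pred x | f x == 0].
Fact linker_submod_closed : submod_closed linker.
Proof.
split; rewrite ?inE ?linear0// => a x y; rewrite !inE => /eqP fx /eqP fy.
by rewrite linearP fx fy scaler0 addr0.
Qed.
HB.instance Definition _ :=
  GRing.isSubmodClosed.Build R V linker linker_submod_closed.
End LinKer.

(* ell2 R I is the Hilbert space of square summable families indexed by I;    *)
(* \ell^2 is ell2 R nat and \ell^2_n is ell2 R 'I_n (see ell2_ord_norm).      *)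
Section SquareSum.
Variables (R : realType) (I : choiceType).
Implicit Types x y : I -> R.

Definition sqsum x : \bar R := \esum_(i in [set: I]) (x i ^+ 2)%:E.

Lemma sqsum_ge0 x : (0 <= sqsum x)%E.
Proof. by apply: esum_ge0 => i _; rewrite lee_fin sqr_ge0. Qed.

Lemma sqsum_leP x c :
  (sqsum x <= c%:E)%E <->
  (forall s : seq I, uniq s -> \sum_(i <- s) x i ^+ 2 <= c).
Proof.
split=> [xc s us|xc].
  rewrite -lee_fin; apply: le_trans xc; rewrite -sumEFin fsbig_seq//.
  by apply: ereal_sup_ubound; exists [set` s] => //; split.
apply: ge_ereal_sup => _ [A [finA _] <-].
by rewrite fsbig_finite// sumEFin lee_fin xc.
Qed.

Lemma sqsum_fineK x : (sqsum x < +oo)%E -> (fine (sqsum x))%:E = sqsum x.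
Proof. by move=> xy; rewrite fineK// ge0_fin_numE ?sqsum_ge0. Qed.

Definition ell2_pred : {pred I -> R} := [pred x | (sqsum x < +oo)%E].

Fact ell2_submod_closed : submod_closed ell2_pred.
Proof.
split.
  rewrite inE (@le_lt_trans _ _ (0%:E)) ?ltry//; apply/sqsum_leP => s _.
  by rewrite big1// => i _; rewrite expr0n.
move=> a x y; rewrite !inE => xf yf.
apply: le_lt_trans (ltry (2 * a ^+ 2 * fine (sqsum x) + 2 * fine (sqsum y))).
apply/sqsum_leP => s us.
have xs : \sum_(i <- s) x i ^+ 2 <= fine (sqsum x).
  by move: s us; apply/sqsum_leP; rewrite sqsum_fineK.
have ys : \sum_(i <- s) y i ^+ 2 <= fine (sqsum y).
  by move: s us {xs}; apply/sqsum_leP; rewrite sqsum_fineK.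
apply: (@le_trans _ _ (\sum_(i <- s) (2 * a ^+ 2 * x i ^+ 2 + 2 * y i ^+ 2))).
  apply: ler_sum => i _; rewrite -subr_ge0.
  rewrite (_ : _ - _ = (a * x i - y i) ^+ 2) ?sqr_ge0//=.
  rewrite -[(a *: x + y) i]/(a * x i + y i); ring.
rewrite big_split/= -!mulr_sumr lerD// ler_wpM2l// mulr_ge0// ?sqr_ge0//.
Qed.

HB.instance Definition _ :=
  GRing.isSubmodClosed.Build R (I -> R) ell2_pred ell2_submod_closed.

Record ell2 := Ell2 { ell2_val :> I -> R; ell2_valP : ell2_val \in ell2_pred }.

HB.instance Definition _ := [isSub for ell2_val].
HB.instance Definition _ := [Choice of ell2 by <:].
HB.instance Definition _ := [SubChoice_isSubLmodule of ell2 by <:].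

Definition ell2_norm (x : ell2) : R := Num.sqrt (fine (sqsum x)).

Lemma ell2_norm_leP (x : ell2) M : 0 <= M ->
  ell2_norm x <= M <->
  (forall s : seq I, uniq s -> \sum_(i <- s) x i ^+ 2 <= M ^+ 2).
Proof.
move=> M0; rewrite -sqsum_leP -(sqsum_fineK (ell2_valP x)) lee_fin.
rewrite /ell2_norm -[in X in X <-> _](ger0_norm M0) -sqrtr_sqr.
by rewrite ler_sqrt ?sqr_ge0.
Qed.

Lemma ell2_norm_ge0 (x : ell2) : 0 <= ell2_norm x. Proof. exact: sqrtr_ge0. Qed.

Lemma ell2_norm_sum (x : ell2) (s : seq I) :
  uniq s -> \sum_(i <- s) x i ^+ 2 <= ell2_norm x ^+ 2.
Proof. by move: s; apply/ell2_norm_leP; rewrite ?ell2_norm_ge0. Qed.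

Lemma ell2_norm_coord (x : ell2) i : `|x i| <= ell2_norm x.
Proof.
have := @ell2_norm_sum x [:: i] isT; rewrite big_seq1 -sqrtr_sqr => xi.
by rewrite -[leRHS](ger0_norm (ell2_norm_ge0 x)) -sqrtr_sqr ler_wsqrtr.
Qed.

Fact ell2_norm0_eq0 (x : ell2) : ell2_norm x = 0 -> x = 0.
Proof.
move=> x0; apply: val_inj; apply/funext => i /=.
by apply/eqP; rewrite -normr_le0 -x0 ell2_norm_coord.
Qed.

Fact ell2_normD (x y : ell2) : ell2_norm (x + y) <= ell2_norm x + ell2_norm y.
Proof.
have [/ell2_norm0_eq0 ->|x0] := eqVneq (ell2_norm x) 0.
  by rewrite add0r lerDr ell2_norm_ge0.
have [/ell2_norm0_eq0 ->|y0] := eqVneq (ell2_norm y) 0.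
  by rewrite addr0 lerDl ell2_norm_ge0.
apply/ell2_norm_leP; first by rewrite addr_ge0 ?ell2_norm_ge0.
move=> s us; set N := ell2_norm x in x0 *; set M := ell2_norm y in y0 *.
have N0 : 0 < N by rewrite lt_neqAle eq_sym x0 ell2_norm_ge0.
have M0 : 0 < M by rewrite lt_neqAle eq_sym y0 ell2_norm_ge0.
apply: (@le_trans _ _
  (\sum_(i <- s) ((1 + M / N) * x i ^+ 2 + (1 + N / M) * y i ^+ 2))).
  apply: ler_sum => i _; rewrite -subr_ge0.
  rewrite -[ell2_val (x + y) i]/(x i + y i).
  rewrite (_ : _ - _ = (M * x i - N * y i) ^+ 2 / (N * M)).
    by apply: divr_ge0; rewrite ?sqr_ge0// mulr_ge0// ltW.
  by field; rewrite x0 y0.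
rewrite big_split/= -!mulr_sumr.
rewrite [leRHS](_ : _ = (1 + M / N) * N ^+ 2 + (1 + N / M) * M ^+ 2); last first.
  by field; rewrite x0 y0.
by apply: lerD; (apply: ler_wpM2l; [by rewrite addr_ge0// divr_ge0// ltW|exact: ell2_norm_sum]).
Qed.

Fact ell2_normZ (l : R) (x : ell2) : ell2_norm (l *: x) = `|l| * ell2_norm x.
Proof.
have leZ k (z : ell2) : ell2_norm (k *: z) <= `|k| * ell2_norm z.
  apply/ell2_norm_leP; first by rewrite mulr_ge0 ?ell2_norm_ge0.
  move=> s us; rewrite exprMn real_normK ?num_real//.
  under eq_bigr do rewrite -[ell2_val (k *: z) _]/(k * z _) exprMn.
  by rewrite -mulr_sumr ler_wpM2l ?sqr_ge0// ell2_norm_sum.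
apply/eqP; rewrite eq_le leZ/=.
have [->|l0] := eqVneq l 0; first by rewrite normr0 mul0r ell2_norm_ge0.
rewrite -ler_pdivlMl ?normr_gt0// -normfV.
by rewrite -[in leLHS](scalerK l0 x) leZ.
Qed.

HB.instance Definition _ :=
  Lmodule_isNormed.Build R ell2 ell2_normD ell2_normZ ell2_norm0_eq0.

Fact ell2_complete (F : set_system ell2) : ProperFilter F -> cauchy F -> cvg F.
Proof.
move=> FF /cauchyP Fc.
have coordD (x y : ell2) i : (x - y) i = x i - y i by [].
have cvgi i : exists l : R, x i @[x --> F] --> l.
  apply/cvg_ex; apply: R_complete; apply/cauchyP => e e0.
  have [z Fz] := Fc e e0; exists (z i).
  suff : F [set t : ell2 | `|z i - t i| < e] by [].
  apply: filterS Fz => t; rewrite -ball_normE /= -coordD => zt.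
  exact: le_lt_trans (ell2_norm_coord _ _) zt.
pose l i : R := sval (cid (cvgi i)).
have lP i : x i @[x --> F] --> l i by exact: (svalP (cid (cvgi i))).
have key (e : R) (z : ell2) : 0 < e -> F (ball z e) ->
    forall s, uniq s -> \sum_(i <- s) (z i - l i) ^+ 2 <= e ^+ 2.
  move=> e0 Fz s us.
  have sc : \sum_(i <- s) (z i - x i) ^+ 2 @[x --> F] -->
            \sum_(i <- s) (z i - l i) ^+ 2.
    apply: cvg_big => [|i _]; first exact: add_continuous.
    by apply: cvgM; (apply: cvgB; [exact: cvg_cst|exact: lP]).
  apply: (cvgr_to_le sc).
  suff : F [set t : ell2 | \sum_(i <- s) (z i - t i) ^+ 2 <= e ^+ 2] by [].
  apply: filterS Fz => t; rewrite -ball_normE /= => /ltW zt.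
  have /ell2_norm_leP : ell2_norm (z - t) <= e by [].
  by move/(_ (ltW e0) s us).
have [z Fz] := Fc 1 ltr01.
have zlP : (z : I -> R) - l \in ell2_pred.
  rewrite inE; apply: le_lt_trans (ltry (1 ^+ 2)); apply/sqsum_leP.
  exact: key Fz.
have lmem : l \in ell2_pred.
  rewrite -[l](subKr (z : I -> R)); apply: rpredB => //; exact: ell2_valP.
apply/cvg_ex; exists (Ell2 lmem); apply/cvgrPdist_le => e e0.
have e20 : 0 < e / 2 by rewrite divr_gt0.
have [w Fw] := Fc _ e20; apply: filterS (Fw) => t.
rewrite -ball_normE /ball_/= => /ltW wt.
rewrite (splitr e) (le_trans (ler_distD w _ _))// lerD//.
rewrite distrC; apply/(ell2_norm_leP _ (ltW e20)).
exact: key Fw.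
Qed.

HB.instance Definition _ := Uniform_isComplete.Build ell2 ell2_complete.

End SquareSum.

Arguments ell2 R I : clear implicits.

Lemma ell2_ord_norm (R : realType) n (x : ell2 R 'I_n) :
  `|x| = Num.sqrt (\sum_(i < n) x i ^+ 2).
Proof.
rewrite -[LHS]/(ell2_norm x) /ell2_norm /sqsum; congr Num.sqrt.
rewrite -[[set: 'I_n]](_ : [set` index_enum 'I_n] = _).
  rewrite esum_fset// => [|i _]; last by rewrite lee_fin sqr_ge0.
  by rewrite -fsbig_seq ?index_enum_uniq// sumEFin.
by apply/seteqP; split => // i _ /=; rewrite mem_index_enum.
Qed.

(* The space \ell^1_n.                                                        *)
Definition ell1 (R : realType) (n : nat) : Type := 'I_n -> R.

Section Ell1.
Variables (R : realType) (n : nat).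

HB.instance Definition _ := GRing.Lmodule.copy (ell1 R n) ('I_n -> R).

Definition ell1_norm (x : ell1 R n) : R := \sum_(i < n) `|x i|.

Fact ell1_normD x y : ell1_norm (x + y) <= ell1_norm x + ell1_norm y.
Proof. by rewrite -big_split; apply: ler_sum => i _; exact: ler_normD. Qed.

Fact ell1_normZ (l : R) x : ell1_norm (l *: x) = `|l| * ell1_norm x.
Proof. by rewrite mulr_sumr; apply: eq_bigr => i _; exact: normrM. Qed.

Fact ell1_norm0_eq0 x : ell1_norm x = 0 -> x = 0.
Proof.
move=> /eqP; rewrite psumr_eq0// => /allP x0; apply/funext => i.
by apply/eqP; rewrite -normr_eq0; apply: x0; rewrite mem_index_enum.
Qed.

HB.instance Definition _ :=
  Lmodule_isNormed.Build R (ell1 R n) ell1_normD ell1_normZ ell1_norm0_eq0.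
End Ell1.

(* Meaningful for a continuous linear f only: sup of an unbounded set is 0.   *)
Definition opnorm (R : realType) (V W : normedModType R) (f : V -> W) : R :=
  sup [set `|f x| | x in [set x | `|x| <= 1]].

(* +oo when V and W are not isomorphic.                                       *)
Definition banach_mazur (R : realType) (V W : normedModType R) : \bar R :=
  ereal_inf [set d : \bar R |
    exists (T : {linear V -> W}) (S : {linear W -> V}),
      [/\ continuous T, continuous S, cancel T S, cancel S T &
          d = (opnorm T * opnorm S)%:E]].

Definition has_dim (R : realType) (V : normedModType R) (S : {pred V})
    (n : nat) : Prop :=
  exists b : 'I_n -> V,
    (forall x, x \in S <-> exists c : 'I_n -> R, x = \sum_i c i *: b i) /\
    (forall c : 'I_n -> R, \sum_i c i *: b i = 0 -> forall i, c i = 0).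

Definition L1_space (R : realType) (F : completeNormedModType R) : Prop :=
  exists2 sigma : R, 1 <= sigma &
    forall (G : submodClosed F) (m : nat), has_dim G m ->
      exists (H : submodClosed F) (n : nat),
        [/\ has_dim H n, {subset G <= H} &
            (banach_mazur (submod_type H) (ell1 R n) <= sigma%:E)%E].

Definition dual_ball (R : realType) (X : normedModType R) :
    set {linear X -> R^o} :=
  [set f | continuous f /\ opnorm f <= 1].
Arguments dual_ball {R} X.

Definition absolutely_summing (R : realType) (X W : normedModType R)
    (u : X -> W) : Prop :=
  exists K : R, forall (n : nat) (x : 'I_n -> X),
    \sum_i `|u (x i)| <=
    K * sup [set \sum_i `|f (x i)| | f in dual_ball X].

Definition GT_space (R : realType) (X : normedModType R) : Prop :=
  forall u : {linear X -> ell2 R nat}, continuous u -> absolutely_summing u.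

(* The norm of the class of y in the quotient of Y by ker q.                  *)
Definition quotient_norm (R : realType) (Y Z : normedModType R)
    (q : {linear Y -> Z}) (y : Y) : R :=
  inf [set `|y + k| | k in [set k | q k = 0]].

(* Injectivity of the induced map is automatic.                               *)
Definition quotient_map (R : realType) (Y Z : normedModType R)
    (q : {linear Y -> Z}) : Prop :=
  [/\ continuous q, (forall z, exists y, q y = z) &
      forall y, `|q y| = quotient_norm q y].

Record twisted_sum (R : realType) (X Z : completeNormedModType R) := TwistedSum {
  ts_space :> completeNormedModType R;
  ts_inj : {linear X -> ts_space};
  ts_proj : {linear ts_space -> Z};
  ts_inj_isometry : forall x, `|ts_inj x| = `|x|;
  ts_proj_quotient : quotient_map ts_proj;
  ts_exact : forall y, ts_proj y = 0 <-> exists x, ts_inj x = y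
}.

Section Splitting.
Variables (R : realType) (X Z : completeNormedModType R).
Variable Y : twisted_sum X Z.

Definition ts_section (v : {linear Z -> Y}) : Prop :=
  continuous v /\ forall z, ts_proj Y (v z) = z.

Definition splits : Prop := exists v, ts_section v.

(* The infimum of the empty set is +oo.                                       *)
Definition spl : \bar R :=
  ereal_inf [set (Num.sqrt (opnorm v ^+ 2 +
                    opnorm (fun y : Y => y - v (ts_proj Y y)) ^+ 2))%:E
            | v in [set v | ts_section v]].
End Splitting.

(* Main.v *)
(* Write X for the kernel of Q. All three conditions are compared with the    *)
(* property that every operator u from X to \ell^2 extends to F.              *)
(*                                                                            *)
(* Extension and splitting. A twisted sum Y of \ell^2 and E receives a lift   *)
(* T of Q, because finite dimensional pieces of F look like \ell^1_n and      *)
(* balls of \ell^2 are weakly compact. An extension w of the restriction of T *)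
(* to X makes T - j w vanish on X, so that it factors through E and gives a   *)
(* section. Conversely a section of the pushout of 0 -> X -> F -> E -> 0      *)
(* along u yields an extension of u; the pushout is renormed so that          *)
(* embedding and quotient map are exactly isometric. All bounds are uniform   *)
(* in \ell^2, so (+++) is the extension property with a common constant for   *)
(* all \ell^2_n. It follows from the one for \ell^2 by gluing the u_k with    *)
(* weights 2^-k, and implies it by a weak limit.                              *)
(*                                                                            *)
(* Extension and summability. By Grothendieck's inequality every operator     *)
(* from F to \ell^2 is 1-summing, and so is its restriction to X. Conversely  *)
(* a 1-summing u is 2-summing, which by trace duality bounds it by the norm   *)
(* of the projective tensor product of F and \ell^2_n; Hahn-Banach extends    *)
(* the corresponding functional.                                              *)

(* The pivot is the predicate [extends], used with explicit bounds. Extensions and sections are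
   exchanged by [splits_of_extends], through [L1_lifting], and by [extends_of_splits], through
   [pushout_twisted_sum]. The constants of these two lemmas are fixed before the Hilbert space is
   chosen, so [spl] and the norms of extensions control each other for all \ell^2_n at once.
   [uniform_extends] and [extends_limit] pass between \ell^2 and its finite dimensional versions. On
   the side of summability, [summing_of_extends] rests on [grothendieck_ell2], and
   [extends_of_summing] rests on [trace_bound] and [hahn_banach]. *)
Require Import Defs.
From HB Require Import structures.
From mathcomp Require Import all_boot all_order all_algebra.
From mathcomp Require Import all_classical all_reals all_analysis.
From mathcomp Require Import ring lra.

Set Implicit Arguments.
Unset Strict Implicit.
Unset Printing Implicit Defensive.

Import Order.TTheory GRing.Theory Num.Theory.
Import numFieldNormedType.Exports.

Local Open Scope classical_set_scope.
Local Open Scope ring_scope.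

(** * Bounded operators and extension of linear maps *)

Section LinearBounds.
Variables (R : realType) (V W : normedModType R).
Implicit Types (f : {linear V -> W}) (C : R).

Lemma linear_continuous_bound f : continuous f ->
  exists2 C, 0 < C & forall x, `|f x| <= C * `|x|.
Proof.
move=> /linear_bounded_continuous/linear_boundedP /pinfty_ex_gt0 [C C0 fC].
by exists C.
Qed.

Lemma bounded_linear_cont f C : (forall x, `|f x| <= C * `|x|) -> continuous f.
Proof.
move=> fC; apply/linear_bounded_continuous/linear_boundedP.
near=> r => x; apply: le_trans (fC x) _; apply: ler_wpM2r => //.
Unshelve. all: by end_near. Qed.

Lemma opnorm_ub f C : (forall x, `|f x| <= C * `|x|) ->
  has_ubound [set `|f x| | x in [set x : V | `|x| <= 1]].
Proof.
move=> fC; exists `|C| => _ [x /= x1 <-]; apply: le_trans (fC x) _.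
rewrite (le_trans (ler_norm _))// normrM normr_id.
by rewrite -[leRHS]mulr1 ler_wpM2l.
Qed.

Lemma opnorm_ge0 (f : V -> W) : 0 <= opnorm f.
Proof.
have [ub|nub] := pselect (has_ubound [set `|f x| | x in [set x : V | `|x| <= 1]]).
  apply: le_trans (normr_ge0 (f 0)) _; apply: (ub_le_sup ub).
  by exists 0; rewrite /= ?normr0.
(* For an unbounded set [sup] has its default value 0. *)
by rewrite /opnorm sup_out// => -[].
Qed.

Lemma opnormP f : continuous f -> forall x, `|f x| <= opnorm f * `|x|.
Proof.
move=> /linear_continuous_bound [C _ fC] x.
have [->|x0] := eqVneq x 0; first by rewrite linear0 !normr0 mulr0.
have nx : 0 < `|x| by rewrite normr_gt0.
rewrite -ler_pdivrMr//; apply: (ub_le_sup (opnorm_ub fC)).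
exists (`|x|^-1 *: x) => /=.
  by rewrite normrZ normfV normr_id mulVf ?gt_eqF.
by rewrite linearZ normrZ normfV normr_id mulrC.
Qed.

Lemma opnorm_le (f : V -> W) C : 0 <= C -> (forall x, `|f x| <= C * `|x|) -> opnorm f <= C.
Proof.
move=> C0 fC; apply: ge_sup.
  by exists `|f 0|, 0; rewrite //= normr0.
move=> _ [x /= x1 <-]; rewrite (le_trans (fC x))//.
by rewrite -[leRHS]mulr1 ler_wpM2l.
Qed.

End LinearBounds.

Lemma linear_pack (R : pzRingType) (V W : lmodType R) (f : V -> W) :
  linear f -> exists g : {linear V -> W}, g =1 f.
Proof.
by move=> fl; pose g : {linear V -> W} := HB.pack f (GRing.isLinear.Build _ _ _ _ _ fl); exists g.
Qed.

Section LinearExtension.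
Variables (R : pzRingType) (V W : lmodType R).
Implicit Types G : set (V * W).

Definition linear_graph G :=
  [/\ G 0, forall a x y, G x -> G y -> G (a *: x + y) &
      forall w, G (0, w) -> w = 0].

Variable P : V -> W -> Prop.

Definition P_graph G := linear_graph G /\ forall x, G x -> P x.1 x.2.

(* Zorn's lemma for graphs of partial linear maps; the constraint P is        *)
(* pointwise, hence inherited by unions of chains.                            *)
Lemma linear_extension G0 : P_graph G0 ->
  (forall G, P_graph G -> forall v, (forall w, ~ G (v, w)) ->
     exists w, P_graph [set x | exists a y, G y /\ x = a *: (v, w) + y]) ->
  exists f : {linear V -> W},
    (forall x, G0 x -> f x.1 = x.2) /\ (forall v, P v (f v)).
Proof.
move=> [[G00 G0l G0f] G0P] step.
(* Zorn's lemma is also fed the empty chain, with empty union; joining [G0] to every member makes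
   this union admissible. *)
pose PG := [set A : set (V * W) | P_graph (G0 `|` A)].
have [|A [[[G0' Gl Gf] GP] Amax]] := @Zorn_bigcup _ PG.
  move=> F FP Ftot; have [[A FA]|F0] := pselect (exists A, F A); last first.
    rewrite /PG/= (_ : \bigcup_(X in F) X = set0) ?setU0//.
    by apply/seteqP; split=> // x [A FA _]; case: F0; exists A.
  have inF x : (G0 `|` \bigcup_(X in F) X) x -> exists2 B, F B & (G0 `|` B) x.
    by move=> [G0x|[B FB Bx]]; [exists A => //; left|exists B => //; right].
  have outF B x : F B -> (G0 `|` B) x -> (G0 `|` \bigcup_(X in F) X) x.
    by move=> FB [G0x|Bx]; [left|right; exists B].
  split; first split.
  - by left.
  - move=> a x y /inF[B FB Bx] /inF[C FC Cy].
    have [BC|CB] := Ftot _ _ FB FC.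
      apply: (outF C) => //; have [[_ l _] _] := FP _ FC; apply: l => //.
      by case: Bx => [|/BC]; [left|right].
    apply: (outF B) => //; have [[_ l _] _] := FP _ FB; apply: l => //.
    by case: Cy => [|/CB]; [left|right].
  - by move=> w /inF[B FB]; have [[_ _ f] _] := FP _ FB; exact: f.
  - by move=> x /inF[B FB]; have [_] := FP _ FB; exact.
set G := G0 `|` A in G0' Gl Gf GP.
have tot v : exists w, G (v, w).
  apply: contrapT => /forallNP nv.
  have [|w PGw] := step G _ v nv; first by [].
  pose A' := [set x | exists a y, G y /\ x = a *: (v, w) + y].
  apply: (Amax A').
    split; last first.
      move=> AA'; apply: (nv w); right; apply: AA'.
      by exists 1, 0; split=> //; rewrite scale1r addr0.
    by move=> x Ax; exists 0, x; split; [right|rewrite scale0r add0r].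
  rewrite /PG/= (_ : G0 `|` A' = A')//; apply/seteqP; split; last by right.
  by move=> x [G0x|//]; exists 0, x; split; [left|rewrite scale0r add0r].
pose f v := sval (cid (tot v)).
have fG v : G (v, f v) by exact: (svalP (cid (tot v))).
have Gu v w w' : G (v, w) -> G (v, w') -> w = w'.
  move=> Gw Gw'; apply/eqP; rewrite -subr_eq0; apply/eqP/Gf.
  rewrite (_ : (0, w - w') = -1 *: (v, w') + (v, w)); first exact: Gl.
  by rewrite scaleN1r; congr pair; rewrite /= ?addNr// addrC.
have flin : linear f.
  by move=> a x y; apply: Gu (fG _) _; exact: (Gl a (x, f x) (y, f y)).
have [g gE] := linear_pack flin; exists g; split => [[v w] G0x|v]; rewrite gE.
  by apply: Gu (fG _) _; left.
exact: GP (fG v).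
Qed.

End LinearExtension.

(** Each new vector may be sent to 0, so no bound on [U] is available outside S. This is enough: the
    pushout norm and the trace functional bound [U] only on the kernel of Q. *)
Lemma algebraic_extension (R : realType) (V W : normedModType R)
    (S : submodClosed V) (u : {linear submod_type S -> W}) :
  exists U : {linear V -> W}, forall x : submod_type S, U (val x) = u x.
Proof.
pose G0 : set (V * W) := [set y | exists x : submod_type S, y = (val x, u x)].
have [||U [UG _]] := @linear_extension R V W (fun _ _ => True) G0.
- split => //; split.
  + by exists 0; rewrite !linear0.
  + by move=> a _ _ [x ->] [y ->]; exists (a *: x + y); rewrite !linearP.
  + move=> w [x [x0 ->]]; rewrite (_ : x = 0) ?linear0//.
    by apply: val_inj; exact/esym.
- move=> G [[G0' Gl Gf] _] v nv; exists 0; split => //; split.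
  + by exists 0, 0; rewrite scale0r addr0.
  + move=> a _ _ [b [y [Gy ->]]] [c [z [Gz ->]]].
    exists (a * b + c), (a *: y + z); split; first exact: Gl.
    by rewrite scalerDr scalerDl scalerA addrACA.
  + move=> w [a [[y y'] [Gy e]]].
    have avy : 0 = a *: v + y by exact: (congr1 fst e).
    have wy : w = a *: 0 + y' by exact: (congr1 snd e).
    rewrite {e} wy scaler0 add0r.
    have [a0|a0] := eqVneq a 0.
      by apply: Gf; move: Gy; rewrite avy a0 scale0r add0r.
    exfalso; apply: (nv (- a^-1 *: y')).
    rewrite (_ : (_, _) = - a^-1 *: (y, y') + 0); first exact: Gl.
    rewrite addr0; congr pair.
    have -> : y = - (a *: v) by apply/eqP; rewrite -addr_eq0 addrC -avy.
    by rewrite /= scalerN scaleNr opprK scalerA mulVf// scale1r.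
by exists U => x; apply: (UG (val x, u x)); exists x.
Qed.

(** * The Hahn-Banach theorem for sublinear functionals *)

Section HahnBanach.
Variables (R : realType) (V : lmodType R) (p : V -> R).
Hypothesis pD : forall x y, p (x + y) <= p x + p y.
Hypothesis pZ : forall (a : R) x, 0 < a -> p (a *: x) = a * p x.

Local Notation below := (fun (x : V) (w : R^o) => (w : R) <= p x).

(** Domination by p is a pointwise constraint, so [linear_extension] applies. It also forces
    single-valuedness: if [(0, w)] lies in the graph, then w and -w are both at most [p 0 = 0]. *)
Lemma hahn_banach (D : set V) (phi : V -> R) :
  D 0 -> (forall a x y, D x -> D y -> D (a *: x + y)) ->
  (forall a x y, D x -> D y -> phi (a *: x + y) = a * phi x + phi y) ->
  (forall x, D x -> phi x <= p x) ->
  exists f : {linear V -> R^o},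
    (forall x, D x -> f x = phi x) /\ (forall x, f x <= p x).
Proof.
move=> D0 Dl phil phip.
have phi0 : phi 0 = 0.
  have := phil (-1) 0 0 D0 D0.
  by rewrite scaler0 addr0 mulN1r addNr.
have p0 : p 0 = 0.
  have := @pZ 2 0 (ltr0Sn R 1); rewrite scaler0; lra.
pose G0 : set (V * R^o) := [set y | D y.1 /\ y.2 = phi y.1].
have PG_graph (G : set (V * R^o)) : G 0 -> (forall a x y, G x -> G y -> G (a *: x + y)) ->
    (forall x, G x -> (x.2 : R) <= p x.1) -> P_graph below G.
  move=> G0' Gl GP; split=> //; split=> // w Gw.
  have /GP : G (-2 *: (0, w) + (0, w)) by exact: Gl.
  rewrite -[_.1]/(-2 *: 0 + 0) -[_.2]/(-2 * w + w) scaler0 addr0 p0.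
  have := GP _ Gw; rewrite /= p0; lra.
have [||f [fG fp]] := @linear_extension R V R^o below G0.
- apply: PG_graph.
  + by split=> //=; rewrite phi0.
  + move=> a [x x'] [y y'] [/= Dx ->] [/= Dy ->]; split => /=; first exact: Dl.
    by rewrite phil.
  + by move=> [x x'] [/= Dx ->]; exact: phip.
- move=> G [[G0' Gl Gf] GP] v nv.
  (* The elements of [A] are the lower bounds for an admissible value at v; subadditivity puts them
     below all the upper bounds [p (z + v) - z'], so [sup A] satisfies both families. *)
  pose A := [set y.2 - p (y.1 - v) | y in G].
  have Aub z z' : G (z, z') -> ubound A (p (z + v) - z').
    move=> Gz _ [[y y'] Gy <-] /=.
    have /GP/= := Gl 1 _ _ Gz Gy; rewrite !scale1r => yz.
    rewrite lerBrDr addrAC lerBlDr [leLHS]addrC (le_trans yz)// (le_trans _ (pD _ _))//.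
    by rewrite addrACA subrr addr0.
  have A0 : A !=set0 by exists (0 - p (0 - v)), 0.
  pose c := sup A.
  have cub z z' : G (z, z') -> z' + c <= p (z + v).
    by move=> Gz; rewrite addrC -lerBrDr; apply: ge_sup => //; exact: Aub.
  have clb z z' : G (z, z') -> z' - c <= p (z - v).
    move=> Gz; rewrite lerBlDr -lerBlDl; apply: ub_le_sup.
      by exists (p (0 + v) - 0); exact: Aub.
    by exists (z, z').
  exists c; apply: PG_graph.
  + by exists 0, 0; rewrite scale0r addr0.
  + move=> a _ _ [b [y [Gy ->]]] [d [z [Gz ->]]].
    exists (a * b + d), (a *: y + z); split; first exact: Gl.
    by rewrite scalerDr scalerDl scalerA addrACA.
  + move=> _ [a [[y y'] [Gy ->]]] /=; rewrite -[a *: c]/(a * c).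
    have Gs b : G (b *: y, b * y').
      by have := Gl b _ _ Gy G0'; rewrite addr0.
    have [a0|a0|->] := ltgtP a 0; last by rewrite mul0r scale0r !add0r; exact: GP Gy.
    * have := clb _ _ (Gs (- a^-1)).
      have na0 : 0 < - a by rewrite oppr_gt0.
      rewrite -(ler_pM2l na0) -pZ// scalerBr scalerA mulrNN divff ?lt_eqF//.
      rewrite scale1r scaleNr opprK [y + _]addrC.
      by rewrite (_ : - a * (- a^-1 * y' - c) = a * c + y')//; field; rewrite lt_eqF.
    * have := cub _ _ (Gs a^-1).
      rewrite -(ler_pM2l a0) -pZ// scalerDr scalerA divff ?gt_eqF// scale1r [y + _]addrC.
      by rewrite (_ : a * (a^-1 * y' + c) = a * c + y')//; field; rewrite gt_eqF.
exists f; split=> // x Dx.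
by apply: (fG (x, phi x)).
Qed.

End HahnBanach.

(** * The open mapping theorem *)

Section OpenMapping.
Variables (R : realType) (V W : completeNormedModType R) (Q : {linear V -> W}).
Hypotheses (Qc : continuous Q) (Qs : forall y, exists x, Q x = y).

(** By Baire's theorem the closure of the image of some ball contains a ball around some [y0]. A
    small multiple of y is the difference of two points of the latter, hence nearly the image of a
    difference of two bounded vectors. *)
Lemma approximate_preimage : exists2 M : R, 0 < M &
  forall y, exists x, `|x| <= M * `|y| /\ `|y - Q x| <= `|y| / 2.
Proof.
pose B (n : nat) := [set Q x | x in [set x | `|x| <= n%:R]].
have [n nd] : exists n, ~ dense (~` closure (B n)).
  apply: contrapT => /forallNP d.
  have : dense (\bigcap_n (~` closure (B n))).
    apply: Baire => n; split; first by rewrite openC; exact: closed_closure.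
    exact: contrapT (d n).
  case/(_ setT); [by exists 0|exact: openT|].
  move=> y [_ yB]; have [x xy] := Qs y.
  have := yB (Num.truncn `|x|).+1 Logic.I; apply; apply: subset_closure.
  by exists x => //=; exact/ltW/truncnS_gt.
have [G [[y0 /open_nbhs_nbhs/nbhs_ballP[r /= r0 rG]] GB]] := denseNE nd.
have nearQ y e : 0 < e -> `|y0 - y| < r ->
    exists2 x, `|x| <= n%:R & `|y - Q x| < e.
  move=> e0 yr; have yB : closure (B n) y.
    apply: contrapT => nyB; rewrite -[False]/(set0 y) -GB; split => //.
    by apply: rG; rewrite -ball_normE.
  have [_ [[x /= xn <-]]] := yB _ (nbhsx_ballx y e e0).
  by rewrite -ball_normE /= => yx; exists x.
exists (4 * n%:R / r + 1) => [|y].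
  by rewrite ltr_wpDl// divr_ge0 ?mulr_ge0// ltW.
have [->|yN0] := eqVneq y 0.
  by exists 0; rewrite linear0 subr0 !normr0 mul0r mulr0.
have y_gt0 : 0 < `|y| by rewrite normr_gt0.
(* Then [k^-1 *: y] has norm r / 2, inside the ball, and two errors of r / 8 become at most
   [|y| / 2] after scaling back by k. *)
pose k := 2 * `|y| / r.
have k0 : 0 < k by rewrite divr_gt0// mulr_gt0.
have r80 : 0 < r / 8 by rewrite divr_gt0.
have [|x1 x1n yx1] := nearQ (y0 + k^-1 *: y) _ r80.
  rewrite opprD addNKr normrN normrZ gtr0_norm ?invr_gt0//.
  rewrite (_ : k^-1 * `|y| = r / 2); last by rewrite /k; field; rewrite !gt_eqF.
  by rewrite gtr_pMr// invf_lt1// ltr1n.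
have [|x2 x2n yx2] := nearQ y0 _ r80; first by rewrite subrr normr0.
exists (k *: (x1 - x2)); split.
  rewrite normrZ gtr0_norm// (@le_trans _ _ (k * (n%:R + n%:R)))//.
    by rewrite ler_pM2l// (le_trans (ler_normB _ _))// lerD.
  rewrite mulrDl mul1r (_ : k * _ = 4 * n%:R / r * `|y|) ?lerDl//.
  by rewrite /k; field; rewrite gt_eqF.
rewrite linearZ linearB/=.
have -> : y - k *: (Q x1 - Q x2) = k *: ((y0 + k^-1 *: y - Q x1) - (y0 - Q x2)).
  have -> : (y0 + k^-1 *: y - Q x1) - (y0 - Q x2) = k^-1 *: y - (Q x1 - Q x2).
    by rewrite opprB [LHS]addrC !addrA subrK opprB addrA [_ + Q x2]addrC.
  by rewrite [in RHS]scalerBr scalerA divff ?gt_eqF// scale1r.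
rewrite normrZ gtr0_norm//.
apply: (@le_trans _ _ (k * (r / 8 + r / 8))).
  by rewrite ler_pM2l// (le_trans (ler_normB _ _))// lerD// ltW.
by rewrite le_eqVlt; apply/orP; left; apply/eqP; rewrite /k; field; rewrite gt_eqF.
Qed.

(** Successive correction: the remainders [y_ k] halve at each step, so the corrections [x_ k] form
    an absolutely convergent series, which by continuity Q maps to y. *)
Lemma bounded_preimage : exists2 M : R, 0 < M &
  forall y, exists2 x, Q x = y & `|x| <= M * `|y|.
Proof.
have [M M0 /choice[h hP]] := approximate_preimage.
exists (2 * M) => [|y]; first by rewrite mulr_gt0.
pose y_ k := iter k (fun z => z - Q (h z)) y.
have yk k : `|y_ k| <= `|y| / 2 ^+ k.
  elim: k => [|k IH]; first by rewrite expr0 divr1.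
  rewrite (le_trans (hP _).2)// exprSr invfM mulrA.
  by rewrite ler_wpM2r.
pose x_ k := h (y_ k).
have xk k : `|x_ k| <= M * `|y| / 2 ^+ k.
  by rewrite (le_trans (hP _).1)// -mulrA ler_pM2l.
have Qx k : Q (series x_ k) = y - y_ k.
  elim: k => [|k IH]; first by rewrite /series/= big_geq// linear0 subrr.
  by rewrite /series/= big_nat_recr//= linearD/= -/(series x_ k) IH opprB addrA addrAC.
have geo : geometric (M * `|y|) 2^-1 = fun k => M * `|y| / 2 ^+ k.
  by apply/funext => k /=; rewrite exprVn.
have half1 : `|2^-1 : R| < 1 by rewrite ger0_norm// invf_lt1// ltr1n.
have cvgN : cvgn [normed series x_].
  apply: (@series_le_cvg _ _ (geometric (M * `|y|) 2^-1)) => [k|k|k|].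
  - exact: normr_ge0.
  - by rewrite geo divr_ge0 ?exprn_ge0// mulr_ge0// ltW.
  - by rewrite geo; exact: xk.
  - exact: is_cvg_geometric_series.
have /cvg_ex[x xP] := normed_cvg cvgN.
exists x.
  have c1 : Q (series x_ k) @[k --> \oo] --> Q x.
    by apply: continuous_cvg => //; exact: Qc.
  have c2 : Q (series x_ k) @[k --> \oo] --> y.
    rewrite (_ : (fun k => _) = (fun k => y - y_ k)); last exact/funext.
    have y0 : y_ k @[k --> \oo] --> 0.
      apply/norm_cvg0P.
      apply: (@squeeze_cvgr _ _ _ _ (fun=> 0) (geometric `|y| 2^-1)).
      - by near=> k; rewrite normr_ge0/= exprVn.
      - exact: cvg_cst.
      - exact: cvg_geometric.
    by have := cvgB (cvg_cst y) y0; rewrite subr0; apply.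
  exact: (cvg_unique _ c1 c2).
have := lim_series_norm cvgN; rewrite (cvg_lim _ xP)// => /le_trans; apply.
apply: limr_le => //; near=> k.
apply: (@le_trans _ _ (series (geometric (M * `|y|) 2^-1) k)).
  by apply: ler_sum => i _; rewrite geo; exact: xk.
apply: le_trans (@geometric_le_lim _ _ _ _ _ _ _) _ => //.
- by rewrite mulr_ge0// ltW.
- by rewrite le_eqVlt; apply/orP; left; apply/eqP; field.
Unshelve. all: by end_near. Qed.

End OpenMapping.

(** * Weak limits in \ell^2 *)

Section UltraLimit.
Variables (R : realType) (T : Type) (U : set_system T).
Hypothesis UU : UltraFilter U.

Lemma ultra_bounded_cvg (b : T -> R) (M : R) : (\forall t \near U, `|b t| <= M) ->
  exists l : R, b t @[t --> U] --> l.
Proof.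
move=> bM; have Up : ProperFilter U := ultra_proper.
have [|l [_ lcl]] := @segment_compact R (- M) M (b @ U) _.
  suff : U [set t | b t \in `[- M, M]] by [].
  by apply: filterS bM => t /=; rewrite in_itv/= ler_norml.
exists l => B Bl; have [//|nB] := in_ultra_setVsetC (b @^-1` B) UU.
by have [x [nBx /nBx]] := lcl (~` B) B nB Bl.
Qed.

(** Weak compactness of balls: the limit is taken in each coordinate, and the bound survives because
    it is tested on finite sums of squares. *)
Lemma ultra_ell2_cvg (I : choiceType) (b : T -> ell2 R I) (M : R) : 0 <= M ->
  (\forall t \near U, `|b t| <= M) ->
  exists2 l : ell2 R I, `|l| <= M & forall i, b t i @[t --> U] --> l i.
Proof.
move=> M0 bM; have Up : ProperFilter U := ultra_proper.
have coord i : exists l : R, b t i @[t --> U] --> l.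
  apply: (@ultra_bounded_cvg _ M); apply: filterS bM => t.
  by apply: le_trans; exact: ell2_norm_coord.
pose l i := sval (cid (coord i)).
have lP i : b t i @[t --> U] --> l i by exact: (svalP (cid (coord i))).
have lM (s : seq I) : uniq s -> \sum_(i <- s) l i ^+ 2 <= M ^+ 2.
  move=> us.
  have sc : \sum_(i <- s) b t i ^+ 2 @[t --> U] --> \sum_(i <- s) l i ^+ 2.
    apply: cvg_big => [|i _]; first exact: add_continuous.
    by apply: cvgM; exact: lP.
  apply: (cvgr_to_le sc).
  have : U [set t | `|b t| <= M] by [].
  apply: filterS => t /= tM; move: us; move: s {sc}.
  by apply/ell2_norm_leP.
have lmem : l \in @ell2_pred R I.
  by rewrite inE; apply: le_lt_trans (ltry (M ^+ 2)); apply/sqsum_leP.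
by exists (Ell2 lmem) => //; apply/ell2_norm_leP.
Qed.

End UltraLimit.

Lemma uniq_pmap (A B : eqType) (d : A -> option B) (s : seq A) :
  (forall a a' b, d a = Some b -> d a' = Some b -> a = a') ->
  uniq s -> uniq (pmap d s).
Proof.
move=> dI; elim: s => //= a s IH /andP[nas /IH us].
case da : (d a) => [b|] //=; rewrite us andbT.
apply: contra nas; rewrite mem_pmap => /mapP[a' a's /esym da'].
by rewrite (dI _ _ _ da da').
Qed.

Section Ell2Pull.
Variables (R : realType) (I J : choiceType) (d : I -> option J).
Hypothesis d_inj : forall i i' j, d i = Some j -> d i' = Some j -> i = i'.

(** Each j is used at most once, so reindexing along [d] is a contraction. Choices of [d] give
    padding by zeros, truncation, the identification of \ell^2 over nat * nat with \ell^2, and the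
    extraction of one block. *)
Lemma ell2_pull : exists2 P : {linear ell2 R J -> ell2 R I},
  (forall h, `|P h| <= `|h|) &
  forall h i, P h i = if d i is Some j then h j else 0.
Proof.
pose g (h : ell2 R J) i : R := if d i is Some j then h j else 0.
have gle h (s : seq I) : uniq s -> \sum_(i <- s) g h i ^+ 2 <= `|h| ^+ 2.
  move=> us; rewrite (_ : \sum_(i <- s) _ = \sum_(j <- pmap d s) h j ^+ 2).
    by apply: ell2_norm_sum; exact: uniq_pmap.
  elim: s {us} => [|i s IH]; first by rewrite !big_nil.
  rewrite big_cons IH /= /g; case: (d i) => [j|] /=; first by rewrite big_cons.
  by rewrite expr0n add0r.
have gmem h : g h \in @ell2_pred R I.
  rewrite inE; apply: le_lt_trans (ltry (`|h| ^+ 2)); apply/sqsum_leP.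
  exact: gle.
have Pl : linear (fun h => Ell2 (gmem h)).
  move=> a x y; apply: val_inj; apply/funext => i /=.
  rewrite -[RHS]/(a * g x i + g y i) /g.
  by case: (d i) => [//|]; rewrite mulr0 addr0.
have [P PE] := linear_pack Pl; exists P => h.
  by rewrite PE; apply/ell2_norm_leP => //; exact: gle.
by move=> i; rewrite PE.
Qed.

End Ell2Pull.

(** * Lifting operators on \mathcal L_1-spaces *)

Section FiniteSpan.
Variables (R : realType) (V : normedModType R) (n : nat) (b : 'I_n -> V).

Definition fin_span : {pred V} :=
  [pred x | `[< exists c : 'I_n -> R, x = \sum_i c i *: b i >]].

Fact fin_span_submod_closed : submod_closed fin_span.
Proof.
split; first by apply/asboolP; exists (fun=> 0); rewrite big1// => i _; rewrite scale0r.
move=> a x y /asboolP[c ->] /asboolP[d ->]; apply/asboolP.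
exists (fun i => a * c i + d i); rewrite scaler_sumr -big_split/=.
by apply: eq_bigr => i _; rewrite scalerDl scalerA.
Qed.

HB.instance Definition _ :=
  GRing.isSubmodClosed.Build R V fin_span fin_span_submod_closed.

Lemma fin_spanP x :
  reflect (exists c : 'I_n -> R, x = \sum_i c i *: b i) (x \in fin_span).
Proof. exact: asboolP. Qed.

End FiniteSpan.

(** [L1_space] speaks of subspaces with a basis, so a vector is added to the basis only if it lies
    outside the span of the previous ones. *)
Lemma seq_in_finite_dim (R : realType) (V : normedModType R) (s : seq V) :
  exists (G : submodClosed V) (m : nat), has_dim G m /\ {subset s <= G}.
Proof.
suff [m [b [bfree bs]]] : exists m (b : 'I_m -> V),
    (forall c : 'I_m -> R, \sum_i c i *: b i = 0 -> forall i, c i = 0) /\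
    {subset s <= fin_span b}.
  exists (fin_span b : submodClosed V), m; split=> //; exists b; split=> // x.
  by split=> [/fin_spanP//|xb]; apply/fin_spanP.
elim: s => [|x s [m [b [bfree bs]]]].
  by exists 0, (fun=> 0); split=> // c _ [].
have [xb|xb] := boolP (x \in fin_span b).
  exists m, b; split=> // y; rewrite inE => /orP[/eqP->//|]; exact: bs.
pose b' (i : 'I_m.+1) := oapp b x (unlift ord0 i).
have b'E c : \sum_i c i *: b' i = c ord0 *: x + \sum_i c (lift ord0 i) *: b i.
  rewrite big_ord_recl /b' unlift_none; congr (_ + _).
  by apply: eq_bigr => i _; rewrite liftK.
exists m.+1, b'; split.
  move=> c; rewrite b'E => cx0.
  have c0 : c ord0 = 0.
    apply/eqP/negPn/negP => c0; move/negP: xb; apply.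
    apply/fin_spanP; exists (fun i => - (c ord0)^-1 * c (lift ord0 i)).
    under eq_bigr do rewrite -scalerA.
    rewrite -scaler_sumr; move/eqP: cx0; rewrite addrC addr_eq0 => /eqP->.
    by rewrite scalerN scaleNr opprK scalerA mulVf// scale1r.
  move=> i; case: (unliftP ord0 i) => [j|] -> //.
  by apply: (bfree (fun i => c (lift ord0 i))); move: cx0; rewrite c0 scale0r add0r.
move=> y; rewrite inE => /orP[/eqP->|/bs/fin_spanP[c ->]]; apply/fin_spanP.
  exists (fun i => (i == ord0)%:R); rewrite b'E eqxx scale1r big1 ?addr0// => i _.
  by rewrite scale0r.
exists (fun i => oapp c 0 (unlift ord0 i)); rewrite b'E unlift_none scale0r add0r.
by apply: eq_bigr => i _; rewrite liftK.
Qed.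

Lemma ell1_basis (R : realType) n (x : ell1 R n) :
  x = \sum_j x j *: ((fun k => (k == j)%:R) : ell1 R n).
Proof.
apply/funext => k.
have -> : (\sum_j x j *: ((fun k => (k == j)%:R) : ell1 R n)) k =
    \sum_j x j * (k == j)%:R :> R.
  exact: (@big_morph _ _ (fun f : ell1 R n => f k) 0 +%R).
rewrite (bigD1 k)//= eqxx mulr1 big1 ?addr0// => j jk.
by rewrite eq_sym (negPf jk) mulr0.
Qed.

(* The rescaled coordinates of an isomorphism onto \ell^1_n whose distortion  *)
(* is at most C.                                                              *)
Lemma L1_local_coordinates (R : realType) (F : completeNormedModType R) :
  L1_space F -> exists2 C : R, 0 < C & forall s : seq F,
    exists (H : submodClosed F) n (t : F -> 'I_n -> R) (b : 'I_n -> F),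
    [/\ {subset s <= H},
        forall a x y j, x \in H -> y \in H -> t (a *: x + y) j = a * t x j + t y j,
        forall x, x \in H -> x = \sum_j t x j *: b j,
        forall j, `|b j| = 1 &
        forall x, x \in H -> \sum_j `|t x j| <= C * `|x|].
Proof.
move=> [sigma sigma1 FL1]; have sigma0 : 0 < sigma + 1 by lra.
(* The infimum in [banach_mazur] need not be attained; the added 1 leaves room for an actual
   isomorphism. *)
exists (sigma + 1) => // s.
have [G [m [Gm sG]]] := seq_in_finite_dim s.
have [H [n [Hn GH]]] := FL1 G m Gm.
have ss1 : (sigma%:E < (sigma + 1)%:E)%E by rewrite lte_fin ltrDl.
move=> /le_lt_trans/(_ ss1)/ereal_inf_lt[_ [T [S [Tc Sc TS ST ->]]]].
rewrite lte_fin => TSs.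
pose e (j : 'I_n) : ell1 R n := fun k => (k == j)%:R.
have e1 j : `|e j| = 1.
  rewrite -[LHS]/(ell1_norm _) /ell1_norm (bigD1 j)//= /e eqxx normr1.
  by rewrite big1 ?addr0// => k kj; rewrite (negPf kj) normr0.
have Se0 j : `|S (e j)| != 0.
  rewrite normr_eq0; apply/eqP => Se; have := ST (e j); rewrite Se linear0.
  by move=> e0; have := e1 j; rewrite -e0 normr0 => /esym/eqP; rewrite oner_eq0.
(* The coordinates become total functions on F through the default 0; they are meaningful on H
   only. *)
pose i0 : F -> submod_type H := insubd 0.
have i0K x : x \in H -> val (i0 x) = x by move=> xH; rewrite /i0 insubdK.
exists H, n, (fun x j => T (i0 x) j * `|S (e j)|),
  (fun j => `|S (e j)|^-1 *: val (S (e j))); split.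
- by move=> x /sG/GH.
- move=> a x y j xH yH; rewrite (_ : i0 (a *: x + y) = a *: i0 x + i0 y).
    by rewrite linearP -[(_ + _) j]/(a * T (i0 x) j + T (i0 y) j) mulrDl mulrA.
  by apply: val_inj; rewrite linearP/= !i0K// rpredD// rpredZ.
- move=> x xH; rewrite -{1}(i0K x xH) -{1}(TS (i0 x)) {1}(ell1_basis (T (i0 x))).
  rewrite !linear_sum/=; apply: eq_bigr => j _.
  by rewrite !linearZ/= scalerA mulrCA mulVf// mulr1.
- move=> j; rewrite normrZ normfV normr_id.
  by rewrite -[X in _ * X]/`|S (e j)| mulVf.
- move=> x xH; apply: (@le_trans _ _ (\sum_j `|T (i0 x) j| * opnorm S)).
    apply: ler_sum => j _; rewrite normrM normr_id ler_wpM2l//.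
    by rewrite (le_trans (opnormP Sc _))// e1 mulr1.
  rewrite -mulr_suml -[X in X * _]/`|T (i0 x)|.
  apply: (@le_trans _ _ (opnorm T * `|i0 x| * opnorm S)).
    by rewrite ler_wpM2r ?opnorm_ge0// opnormP.
  by rewrite mulrAC -[`|i0 x|]/`|val (i0 x)| i0K// ler_wpM2r// ltW.
Qed.

Lemma quotient_map_preimage (R : realType) (Y Z : normedModType R) (q : {linear Y -> Z}) z (e : R) :
  quotient_map q -> 0 < e -> exists2 y, q y = z & `|y| < `|z| + e.
Proof.
move=> [_ qs qn] e0; have [y qy] := qs z.
have [|_ [k /= k0 <-] yk] := @inf_adherent _ [set `|y + k| | k in [set k | q k = 0]] e e0.
  by split; [exists `|y + 0|, 0; rewrite //= linear0|exists 0 => _ [k _ <-]].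
exists (y + k); first by rewrite linearD k0 addr0.
by rewrite -qy qn.
Qed.

(** Finite lists are directed by inclusion. Along such an ultrafilter any given finite set of
    vectors is eventually contained in the list, so choices made on finite pieces of a space can be
    passed to a limit. *)
Lemma seq_ultrafilter (T : eqType) : exists U : set_system (seq T),
  UltraFilter U /\ forall x : T, U [set s : seq T | x \in s].
Proof.
pose B := [set A : set (seq T) |
  exists s0 : seq T, forall s, {subset s0 <= s} -> A s].
have BF : ProperFilter B.
  apply: Build_ProperFilter_ex => [A [s0 sA]|].
    by exists s0; apply: sA.
  split.
  - by exists [::].
  - move=> A A' [s0 sA] [s0' sA']; exists (s0 ++ s0') => s ss; split.
      by apply: sA => x xs; apply: ss; rewrite mem_cat xs.
    by apply: sA' => x xs; apply: ss; rewrite mem_cat xs orbT.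
  - by move=> A A' AA' [s0 sA]; exists s0 => s /sA/AA'.
have [U [UU BU]] := ultraFilterLemma BF.
exists U; split=> // x; apply: BU; exists [:: x] => s; apply.
by rewrite mem_head.
Qed.

Lemma ts_inj_injective (R : realType) (X Z : completeNormedModType R)
    (Y : twisted_sum X Z) : injective (ts_inj Y).
Proof.
move=> h h' hh'; apply/eqP; rewrite -subr_eq0 -normr_eq0 -(ts_inj_isometry Y).
by rewrite linearB/= hh' subrr normr0.
Qed.

Section Lifting.
Variables (R : realType) (E F : completeNormedModType R) (Q : {linear F -> E}).
Hypotheses (FL1 : L1_space F) (Qc : continuous Q).

(* Over a finite dimensional piece of F, lift the coordinate basis; two lifts *)
(* of the same vector differ by an element of \ell^2, where bounded nets have *)
(* coordinatewise limits.                                                     *)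
Lemma L1_lifting : exists2 C : R, 0 < C &
  forall (I : choiceType) (Y : twisted_sum (ell2 R I) E),
  exists T : {linear F -> Y},
    (forall f, ts_proj Y (T f) = Q f) /\ (forall f, `|T f| <= C * `|f|).
Proof.
have [C C0 loc] := L1_local_coordinates FL1.
have [q q0 Qq] := linear_continuous_bound Qc.
pose K := q + 1; have K0 : 0 < K by rewrite /K; lra.
exists (K + (C * K + K)) => [|I Y].
  by have := mulr_gt0 C0 K0; lra.
pose j := ts_inj Y; pose p := ts_proj Y.
have pj h : p (j h) = 0 by apply/ts_exact; exists h.
have jI : injective j by exact: ts_inj_injective.
have sel f : exists y, p y = Q f /\ `|y| <= K * `|f|.
  have [->|f0] := eqVneq f 0.
    by exists 0; rewrite !linear0 !normr0 mulr0.
  have nf : 0 < `|f| by rewrite normr_gt0.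
  have [y py yf] := quotient_map_preimage (Q f) (ts_proj_quotient Y) nf.
  exists y; split=> //; rewrite (le_trans (ltW yf))// /K mulrDl mul1r lerD2r.
  exact: Qq.
have [s0 s0P] := choice sel.
(* [s0] is a bounded lift of Q that need not be linear. On a finite piece a linear lift [T] exists,
   and [T - s0] takes values in the image of \ell^2; its preimage [h] has the opposite linearity
   defect to that of [s0]. *)
have local (s : seq F) : exists h : F -> ell2 R I,
    (forall f, f \in s -> `|h f| <= (C * K + K) * `|f|) /\
    (forall a f g, f \in s -> g \in s -> a *: f + g \in s ->
      j (h (a *: f + g)) = a *: j (h f) + j (h g) +
                           (a *: s0 f + s0 g - s0 (a *: f + g))).
  have [H [n [t [b [sH tl tb b1 tC]]]]] := loc s.
  pose T f := \sum_i t f i *: s0 (b i).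
  have TlP a f g : f \in s -> g \in s -> T (a *: f + g) = a *: T f + T g.
    move=> fs gs; rewrite scaler_sumr -big_split; apply: eq_bigr => i _.
    by rewrite tl ?sH// scalerDl scalerA.
  have pT f : f \in s -> p (T f - s0 f) = 0.
    move=> fs; rewrite linearB linear_sum/= (s0P f).1 {2}(tb f (sH _ fs)).
    rewrite linear_sum/=; apply/eqP; rewrite subr_eq0; apply/eqP/eq_bigr => i _.
    by rewrite !linearZ/= (s0P _).1.
  have Tn f : f \in s -> `|T f - s0 f| <= (C * K + K) * `|f|.
    move=> fs; rewrite (le_trans (ler_normB _ _))// mulrDl lerD ?(s0P _).2//.
    apply: (le_trans (ler_norm_sum _ _ _)).
    apply: (@le_trans _ _ (\sum_i `|t f i| * K)).
      apply: ler_sum => i _; rewrite normrZ ler_wpM2l//.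
      by have := (s0P (b i)).2; rewrite b1 mulr1.
    by rewrite -mulr_suml mulrAC ler_pM2r// tC// sH.
  have hx f : exists h, f \in s -> j h = T f - s0 f.
    have [fs|_] := boolP (f \in s); last by exists 0.
    by have /ts_exact[h hE] := pT _ fs; exists h.
  have [h hE] := choice hx; exists h; split=> [f fs|a f g fs gs fgs].
    by rewrite -(ts_inj_isometry Y) -/j hE// Tn.
  rewrite !hE// TlP// scalerBr.
  by rewrite [X in _ = X + _]addrACA -opprD addrA subrK.
have [h hP] := choice local.
have [U [UU Um]] := seq_ultrafilter F.
have Up : ProperFilter U by exact: ultra_proper.
have lim f : exists l : ell2 R I, `|l| <= (C * K + K) * `|f| /\
    forall i, h s f i @[s --> U] --> l i.
  have [||l lM lP] := @ultra_ell2_cvg R _ U UU I (fun s => h s f) ((C * K + K) * `|f|).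
  - by rewrite mulr_ge0// addr_ge0 ?mulr_ge0// ltW.
  - have : U [set s : seq F | f \in s] by [].
    by apply: filterS => s /= fs; apply: (hP s).1.
  - by exists l.
have [l lP] := choice lim.
have Tl : linear (fun f => s0 f + j (l f)).
  move=> a f g /=.
  (* The defect [d] of [s0] does not depend on the list s, so it is inherited by the limit [l] and
     cancels in [s0 + j l]. *)
  have [d dE] : exists d, j d = a *: s0 f + s0 g - s0 (a *: f + g).
    apply/ts_exact; rewrite -/p linearB linearP/= !(s0P _).1 linearP.
    by rewrite subrr.
  have -> : l (a *: f + g) = a *: l f + l g + d.
    apply: val_inj; apply/funext => i.
    apply: (cvg_unique _ ((lP (a *: f + g)).2 i)); first exact: Rhausdorff.
    have c : a * h s f i + h s g i + d i @[s --> U] --> (a *: l f + l g + d) i.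
      apply: cvgD; last exact: cvg_cst.
      apply: cvgD; last exact: (lP g).2.
      by apply: cvgM; [exact: cvg_cst|exact: (lP f).2].
    apply: cvg_trans; last exact: c.
    apply: near_eq_cvg.
    have Us : U ([set s : seq F | f \in s] `&` [set s : seq F | g \in s] `&`
        [set s : seq F | a *: f + g \in s]).
      by apply: filterI (Um _); apply: filterI (Um _) (Um _).
    suff : U [set s | a * h s f i + h s g i + d i = h s (a *: f + g) i] by [].
    apply: filterS Us => s [[fs gs] fgs] /=.
    rewrite (_ : h s (a *: f + g) = a *: h s f + h s g + d)//.
    by apply: jI; rewrite (hP s).2// -dE !linearD linearZ.
  by rewrite linearD linearP/= dE scalerDr [RHS]addrACA [LHS]addrC [X in X + _]addrA subrK addrC.
have [T TE] := linear_pack Tl; exists T; split=> f; rewrite TE.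
  by rewrite -/p linearD/= pj addr0 (s0P f).1.
rewrite (le_trans (ler_normD _ _))// mulrDl lerD ?(s0P _).2//.
by rewrite ts_inj_isometry (lP f).1.
Qed.

End Lifting.

(** * Pushouts *)

Section Pushout.
Variables (R : realType) (H E F : completeNormedModType R).
Variables (Q : {linear F -> E}) (U : {linear F -> H}) (c : R).

(* With u the restriction of U to the kernel of Q, this is the pushout of     *)
(* 0 -> ker Q -> F -> E -> 0 along u; the class of (h, f) in the quotient of  *)
(* H * F by the graph of - u is represented by (h + U f, Q f).                *)
Definition pushout of 0 < c & (forall f, Q f = 0 -> `|U f| <= c * `|f|)
    & (forall e, exists2 f, Q f = e & c * `|f| <= `|e|) : Type :=
  (H * E)%type.

Hypothesis c0 : 0 < c.
Hypothesis Uc : forall f, Q f = 0 -> `|U f| <= c * `|f|.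
Hypothesis Qe : forall e, exists2 f, Q f = e & c * `|f| <= `|e|.
Local Notation Y := (pushout c0 Uc Qe).

HB.instance Definition _ := GRing.Lmodule.copy Y (H * E)%type.

(** The pairs [(y.1 - U f, f)] with [Q f = y.2] are the representatives of the class y, so the
    infimum is the quotient norm of H * F under the norm [|h| + c * |f|]. *)
Let costs (y : Y) : set R :=
  [set `|y.1 - U f| + c * `|f| | f in [set f | Q f = y.2]].

Let costs_inf (y : Y) : has_inf (costs y).
Proof.
split; first by have [f fy _] := Qe y.2; exists (`|y.1 - U f| + c * `|f|), f.
by exists 0 => _ [f _ <-]; rewrite addr_ge0// mulr_ge0// ltW.
Qed.

Let cost (y : Y) : R := inf (costs y).

Let cost_le (y : Y) f : Q f = y.2 -> cost y <= `|y.1 - U f| + c * `|f|.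
Proof. by move=> fy; apply: ge_inf; [exact: (costs_inf y).2|exists f]. Qed.

Let le_cost (y : Y) a :
  (forall f, Q f = y.2 -> a <= `|y.1 - U f| + c * `|f|) -> a <= cost y.
Proof.
move=> ay; apply: lb_le_inf; first exact: (costs_inf y).1.
by move=> _ [f fy <-]; exact: ay.
Qed.

Let costD (x y : Y) : cost (x + y) <= cost x + cost y.
Proof.
rewrite -lerBlDr; apply: le_cost => f fx; rewrite lerBlDr -lerBlDl.
apply: le_cost => g gy; rewrite lerBlDl.
apply: le_trans (cost_le (_ : Q (f + g) = (x + y).2)) _.
  by rewrite linearD fx gy.
rewrite linearD opprD -[(x + y).1]/(x.1 + y.1) addrACA.
rewrite [leRHS]addrACA lerD ?ler_normD// -mulrDr.
by rewrite ler_wpM2l ?ler_normD// ltW.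
Qed.

Let cost0 h : cost ((h, 0) : Y) = `|h|.
Proof.
apply/eqP; rewrite eq_le; apply/andP; split.
  by have := @cost_le (h, 0) 0 (linear0 Q); rewrite linear0 subr0 normr0 mulr0 addr0.
apply: le_cost => f /= f0; apply: le_trans (lerD (lexx _) (Uc f0)).
by rewrite -[in leLHS](subrK (U f) h) ler_normD.
Qed.

Let costZ (l : R) (y : Y) : cost (l *: y) = `|l| * cost y.
Proof.
have leZ (k : R) (z : Y) : k != 0 -> cost (k *: z) <= `|k| * cost z.
  move=> k0; rewrite -ler_pdivrMl ?normr_gt0//; apply: le_cost => f fz.
  rewrite ler_pdivrMl ?normr_gt0// mulrDr mulrCA -!normrZ scalerBr.
  apply: le_trans (@cost_le (k *: z) (k *: f) _) _; first by rewrite linearZ/= fz.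
  by rewrite (_ : U (k *: f) = k *: U f) ?linearZ.
have [->|l0] := eqVneq l 0.
  by rewrite scale0r normr0 mul0r -[0]/((0, 0) : Y) cost0 normr0.
apply/eqP; rewrite eq_le leZ//= -ler_pdivlMl ?normr_gt0// -normfV.
by rewrite -[in leLHS](scalerK l0 y) leZ ?invr_eq0.
Qed.

(** The bound on [U] over the kernel makes [cost] isometric on H. The maximum with [|y.2|] makes the
    projection contractive, and the preimages with [c * |f| <= |e|] keep the quotient norm from
    exceeding [|y.2|]. *)
Definition pushout_norm (y : Y) : R := Num.max `|y.2| (cost y).

Fact pushout_normD (x y : Y) :
  pushout_norm (x + y) <= pushout_norm x + pushout_norm y.
Proof.
rewrite /pushout_norm ge_max; apply/andP; split.
  by apply: le_trans (ler_normD _ _) (lerD _ _); rewrite le_max lexx.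
by apply: le_trans (costD _ _) (lerD _ _); rewrite le_max lexx orbT.
Qed.

Fact pushout_normZ (l : R) (y : Y) :
  pushout_norm (l *: y) = `|l| * pushout_norm y.
Proof. by rewrite /pushout_norm costZ normrZ maxr_pMr. Qed.

Fact pushout_norm0_eq0 (y : Y) : pushout_norm y = 0 -> y = 0.
Proof.
case: y => h e yE; have : pushout_norm (h, e) <= 0 by rewrite yE.
rewrite /pushout_norm ge_max/= normr_le0 => /andP[/eqP->].
by rewrite cost0 normr_le0 => /eqP->.
Qed.

HB.instance Definition _ :=
  Lmodule_isNormed.Build R Y pushout_normD pushout_normZ pushout_norm0_eq0.

Lemma pushout_norm_inl h : `|(h, 0) : Y| = `|h|.
Proof.
by rewrite -[LHS]/(pushout_norm _) /pushout_norm cost0 normr0 max_r.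
Qed.

Lemma pushout_norm_snd (y : Y) : `|y.2| <= `|y|.
Proof. by rewrite -[leRHS]/(pushout_norm _) le_max lexx. Qed.

Lemma pushout_norm_le f : `|(U f, Q f) : Y| <= Num.max `|Q f| (c * `|f|).
Proof.
rewrite -[leLHS]/(pushout_norm _) /pushout_norm/= ge_max le_max lexx/= le_max.
by have := @cost_le (U f, Q f) f erefl; rewrite subrr normr0 add0r => ->; rewrite orbT.
Qed.

Lemma pushout_near_kernel (y : Y) : exists h, `|y - (h, 0)| <= `|y.2|.
Proof.
have [f fy cf] := Qe y.2; exists (y.1 - U f).
rewrite (_ : y - _ = (U f, Q f)).
  by apply: le_trans (pushout_norm_le f) _; rewrite ge_max fy lexx.
by rewrite fy; case: (y) => h e; congr pair; rewrite /= ?subKr ?subr0.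
Qed.

(** The three-space argument: the component in E converges to some e, and the remaining freedom is a
    Cauchy filter in H. *)
Fact pushout_complete (G : set_system Y) : ProperFilter G -> cauchy G -> cvg G.
Proof.
move=> GP /cauchyP Gc.
have inl_sub h h' : ((h, 0) : Y) - (h', 0) = (h - h', 0).
  by congr pair; rewrite /= subrr.
have [e eP] : exists e : E, y.2 @[y --> G] --> e.
  apply/cvg_ex; apply: cauchy_cvg; apply/cauchyP => r r0.
  have [z Gz] := Gc r r0; exists z.2.
  suff : G [set t : Y | ball z.2 r t.2] by [].
  apply: filterS Gz => t; rewrite -!ball_normE /= => zt.
  exact: le_lt_trans (pushout_norm_snd (z - t)) zt.
pose y0 : Y := (0, e).
(* [D r] collects the h for which [y0 + (h, 0)] is an r-approximate limit; it is inhabited because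
   every point is as close to H as its component in E is small. *)
pose D r := [set h : H | G (ball (y0 + (h, 0)) r)].
have Dn r : 0 < r -> D r !=set0.
  move=> r0; have r40 : 0 < r / 4 by rewrite divr_gt0.
  have [z Gz] := Gc _ r40.
  have Ge : G [set t : Y | `|e - t.2| < r / 4].
    by have /cvgrPdist_lt/(_ _ r40) := eP.
  have [y [zy /= ye]] := filter_ex (filterI Gz Ge).
  have [h hy] := pushout_near_kernel (y - y0); exists h.
  apply: filterS Gz => t; move: zy; rewrite -!ball_normE /= => zy zt.
  have yh : `|y0 + (h, 0) - y| < r / 4.
    rewrite distrC opprD addrA; apply: le_lt_trans hy _.
    by rewrite -[_.2]/(y.2 - e) distrC.
  apply: le_lt_trans (ler_distD y _ _) _.
  have yz : `|y - t| < r / 4 + r / 4.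
    by apply: le_lt_trans (ler_distD z _ _) _; rewrite ltrD// distrC.
  lra.
have DI r r' : r <= r' -> D r `<=` D r'.
  by move=> rr' h; apply: filterS; exact: le_ball.
pose G' := filter_from [set r : R | 0 < r] D.
have G'P : ProperFilter G'.
  apply: filter_from_proper; last exact: Dn.
  apply: filter_from_filter; first by exists 1 => /=.
  move=> r r' /= r0 r'0; exists (Num.min r r'); first by rewrite /= lt_min r0.
  by move=> h Dh; split; apply: DI Dh; rewrite ge_min lexx ?orbT.
have [h hP] : exists h : H, G' --> h.
  apply/cvg_ex; apply: cauchy_cvg; apply/cauchyP => r r0.
  have r20 : 0 < r / 2 by rewrite divr_gt0.
  have [h Dh] := Dn _ r20; exists h, (r / 2) => // h' Dh'.
  have [y [hy h'y]] := filter_ex (filterI Dh Dh').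
  move: hy h'y; rewrite -!ball_normE /= => hy h'y.
  rewrite -pushout_norm_inl -inl_sub.
  rewrite (_ : _ - _ = (y0 + (h, 0) - y) - (y0 + (h', 0) - y)).
    by rewrite (splitr r); apply: le_lt_trans (ler_normB _ _) (ltrD hy h'y).
  by rewrite opprB addrA subrK opprD addrACA subrr add0r.
apply/cvg_ex; exists (y0 + (h, 0)); apply/cvgrPdist_lt => r r0.
have r20 : 0 < r / 2 by rewrite divr_gt0.
have G'D : G' (D (r / 2)) by exists (r / 2).
have [h' [Dh' hh']] := filter_ex (filterI G'D (hP _ (nbhsx_ballx h _ r20))).
apply: filterS Dh' => t; move: hh'; rewrite -!ball_normE /= => hh' ht.
rewrite (splitr r); apply: le_lt_trans (ler_distD (y0 + (h', 0)) _ _) (ltrD _ ht).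
by rewrite opprD addrACA subrr add0r inl_sub pushout_norm_inl.
Qed.

HB.instance Definition _ := Uniform_isComplete.Build Y pushout_complete.

Lemma pushout_twisted_sum : exists (Z : twisted_sum H E) (k : {linear F -> Z}),
  [/\ forall f, ts_proj Z (k f) = Q f,
      forall f, Q f = 0 -> k f = ts_inj Z (U f) &
      forall f, `|k f| <= Num.max `|Q f| (c * `|f|)].
Proof.
have [j jE] : exists j : {linear H -> Y}, j =1 (fun h => (h, 0)).
  by apply: linear_pack => a x y; congr pair; rewrite /= scaler0 addr0.
have [q qE] : exists q : {linear Y -> E}, q =1 snd by exact: linear_pack.
have [k kE] : exists k : {linear F -> Y}, k =1 (fun f => (U f, Q f)).
  by apply: linear_pack => a x y; rewrite !linearP.
have j_iso h : `|j h| = `|h| by rewrite jE pushout_norm_inl.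
have q_quo : quotient_map q.
  split.
  - by apply: (@bounded_linear_cont _ _ _ _ 1) => y; rewrite qE mul1r pushout_norm_snd.
  - by move=> e; exists ((0, e) : Y); rewrite qE.
  - move=> y; rewrite qE; apply/eqP; rewrite eq_le; apply/andP; split.
      apply: lb_le_inf; first by exists `|y + 0|, 0; rewrite //= linear0.
      move=> _ [z /= z0 <-]; apply: le_trans (pushout_norm_snd _).
      by rewrite -[(y + z).2]/(y.2 + z.2) -(qE z) z0 addr0.
    have [h hy] := pushout_near_kernel y; apply: le_trans hy.
    apply: ge_inf; first by exists 0 => _ [z _ <-].
    by exists (- (h, 0)) => //=; rewrite qE/= oppr0.
have exact_ y : q y = 0 <-> exists h, j h = y.
  split=> [|[h <-]]; last by rewrite qE jE.
  by rewrite qE; case: y => h e /= ->; exists h; rewrite jE.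
exists (TwistedSum j_iso q_quo exact_), k => /=; split => f.
- by rewrite qE kE.
- by move=> f0; rewrite kE jE f0.
- by rewrite kE pushout_norm_le.
Qed.

End Pushout.

(** * Splitting and extension of operators *)

Section ExtensionSplitting.
Variables (R : realType) (E F : completeNormedModType R) (Q : {linear F -> E}).

Definition extends (H : normedModType R)
    (u : {linear submod_type (linker Q) -> H}) (M : R) :=
  exists w : {linear F -> H},
    (forall x, w (val x) = u x) /\ (forall f, `|w f| <= M * `|f|).

Lemma linkerP f : reflect (Q f = 0) (f \in linker Q).
Proof. exact: eqP. Qed.

Lemma linker_mem f : Q f = 0 -> exists x : submod_type (linker Q), val x = f.
Proof. by move=> /linkerP f0; exists (Sub f f0); rewrite SubK. Qed.

Lemma linker_val (x : submod_type (linker Q)) : Q (val x) = 0.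
Proof. exact/linkerP/(valP x). Qed.

Hypotheses (Qc : continuous Q) (Qs : forall e, exists f, Q f = e).

(** The operator u is the restriction to the kernel of a lift of Q. The order of quantifiers
    matters: C precedes I and Y, so a common extension constant yields a common bound for the
    sections. *)
Lemma splits_of_extends : L1_space F -> exists2 C : R, 0 < C &
  forall (I : choiceType) (Y : twisted_sum (ell2 R I) E),
  exists u : {linear submod_type (linker Q) -> ell2 R I},
    (forall x, `|u x| <= C * `|x|) /\
    forall M, 0 <= M -> extends u M ->
      exists2 v : {linear E -> Y}, ts_section v & forall z, `|v z| <= C * (C + M) * `|z|.
Proof.
move=> FL1; have [C C0 lift] := L1_lifting FL1 Qc.
have [D D0 pre] := bounded_preimage Qc Qs.
have ltCD (a : R) : 0 <= a -> C * a <= (C + D) * a.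
  by move=> a0; rewrite ler_wpM2r// lerDl ltW.
(* The sum dominates both the lifting constant C and the open mapping constant D, so that one number
   serves in both bounds. *)
exists (C + D) => [|I Y]; first exact: addr_gt0.
have [T [TQ TC]] := lift I Y.
pose j := ts_inj Y; pose p := ts_proj Y.
have jI : injective j by exact: ts_inj_injective.
have Tj (x : submod_type (linker Q)) : exists h, j h = T (val x).
  by apply/ts_exact; rewrite TQ linker_val.
have [u0 u0P] := choice Tj.
have [u uE] : exists u : {linear submod_type (linker Q) -> ell2 R I}, u =1 u0.
  by apply: linear_pack => a x y; apply: jI; rewrite linearP/= !u0P !linearP.
have uP x : j (u x) = T (val x) by rewrite uE u0P.
exists u; split=> [x|M M0 [w [wu wM]]].
  rewrite -(ts_inj_isometry Y) -/j uP; apply: le_trans (TC _) _.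
  exact: ltCD.
pose A f := T f - j (w f).
have Al : linear A.
  move=> a f g; rewrite /A scalerBr addrACA -opprD -!linearZ/= -!linearD/=.
  by rewrite !linearP.
have pA f : p (A f) = Q f.
  rewrite /A linearB/= TQ (_ : p (j (w f)) = 0) ?subr0//.
  by apply/ts_exact; exists (w f).
have A0 f : Q f = 0 -> A f = 0.
  by move=> /linker_mem[x <-]; rewrite /A wu uP subrr.
have AC f : `|A f| <= (C + M) * `|f|.
  rewrite mulrDl; apply: le_trans (ler_normB _ _) (lerD (TC f) _).
  by rewrite ts_inj_isometry wM.
have [B BE] := linear_pack Al.
have pre' e : exists f, Q f = e /\ `|f| <= D * `|e| by have [f ? ?] := pre e; exists f.
have [s sP] := choice pre'.
(* The selection [s] of preimages need not be linear, but [A] vanishes on the kernel of Q, so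
   [A (s e)] does not depend on the selection. *)
have [v vE] : exists v : {linear E -> Y}, v =1 (fun e => A (s e)).
  apply: linear_pack => a x y; apply/eqP; rewrite -subr_eq0 -!BE -linearP -linearB BE.
  by apply/eqP/A0; rewrite linearB linearP/= !(sP _).1 subrr.
have vC z : `|v z| <= (C + D) * (C + D + M) * `|z|.
  have CM : 0 <= C + M by rewrite addr_ge0// ltW.
  rewrite vE; apply: le_trans (AC _) _.
  apply: le_trans (ler_wpM2l CM (sP z).2) _.
  rewrite mulrCA mulrA; apply: ler_wpM2r => //; apply: ler_pM => //; first exact: ltW.
    by rewrite lerDr ltW.
  by rewrite addrAC lerDl ltW.
exists v => //; split; first exact: bounded_linear_cont vC.
by move=> z; rewrite vE -/p pA (sP z).1.
Qed.

(** The constant c is the inverse of the open mapping constant: the pushout needs [c * |f| <= |e|]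
    for a preimage f of each e, and then admits only operators bounded by c on the kernel. Other
    operators are rescaled. *)
Lemma extends_of_splits : exists2 c : R, 0 < c &
  forall (H : completeNormedModType R) (u : {linear submod_type (linker Q) -> H}),
  (forall x, `|u x| <= c * `|x|) ->
  exists Y : twisted_sum H E, forall (v : {linear E -> Y}) (B : R), 0 <= B ->
    (forall z, ts_proj Y (v z) = z) -> (forall z, `|v z| <= B * `|z|) ->
    extends u (opnorm Q + c + B * opnorm Q).
Proof.
have [D D0 pre] := bounded_preimage Qc Qs.
exists D^-1 => [|H u uc]; first by rewrite invr_gt0.
have [U Uu] := algebraic_extension u.
have [|||Y [k [kQ kU kc]]] := @pushout_twisted_sum R H E F Q U D^-1.
- by rewrite invr_gt0.
- by move=> f /linker_mem[x <-]; rewrite Uu; exact: uc.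
- by move=> e; have [f fe fD] := pre e; exists f => //; rewrite ler_pdivrMl.
exists Y => v B B0 pv vB.
pose j := ts_inj Y; pose p := ts_proj Y.
have jI : injective j by exact: ts_inj_injective.
have ker f : exists h, j h = k f - v (Q f).
  by apply/ts_exact; rewrite linearB/= kQ pv subrr.
have [w0 w0P] := choice ker.
have [w wE] : exists w : {linear F -> H}, w =1 w0.
  apply: linear_pack => a x y; apply: jI; rewrite linearP/= !w0P.
  by rewrite scalerBr addrACA -opprD -!linearZ/= -!linearD/= !linearP.
exists w; split=> [x|f].
  by apply: jI; rewrite wE w0P linker_val linear0 subr0 kU ?linker_val// Uu.
have Qf := opnormP Qc f; have Q0 := opnorm_ge0 Q.
rewrite -(ts_inj_isometry Y) -/j wE w0P mulrDl.
apply: le_trans (ler_normB _ _) (lerD _ _); last first.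
  by apply: le_trans (vB _) _; rewrite -mulrA ler_wpM2l.
apply: le_trans (kc f) _; rewrite mulrDl ge_max; apply/andP; split.
  by apply: le_trans Qf _; rewrite lerDl mulr_ge0// invr_ge0 ltW.
by rewrite lerDr mulr_ge0.
Qed.

End ExtensionSplitting.

Section SplittingConstant.
Variables (R : realType) (X Z : completeNormedModType R) (Y : twisted_sum X Z).

Lemma ts_proj_contraction y : `|ts_proj Y y| <= `|y|.
Proof.
have [_ _ ->] := ts_proj_quotient Y; apply: ge_inf.
  by exists 0 => _ [k _ <-].
by exists 0; rewrite /= ?linear0 ?addr0.
Qed.

Lemma spl_le (v : {linear Z -> Y}) (B : R) : 0 <= B -> ts_section v ->
  (forall z, `|v z| <= B * `|z|) ->
  (spl Y <= (Num.sqrt (B ^+ 2 + (1 + B) ^+ 2))%:E)%E.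
Proof.
move=> B0 vs vB; apply: (@le_trans _ _
  (Num.sqrt (opnorm v ^+ 2 + opnorm (fun y : Y => y - v (ts_proj Y y)) ^+ 2))%:E).
  by apply: ereal_inf_lbound; exists v.
have vpB y : `|y - v (ts_proj Y y)| <= (1 + B) * `|y|.
  rewrite mulrDl mul1r; apply: le_trans (ler_normB _ _) _; rewrite lerD2l.
  by apply: le_trans (vB _) _; rewrite ler_wpM2l// ts_proj_contraction.
rewrite lee_fin ler_wsqrtr// lerD// lerXn2r ?nnegrE ?opnorm_ge0 ?addr_ge0//.
  exact: opnorm_le.
by apply: opnorm_le => //; exact: addr_ge0.
Qed.

Lemma spl_lt (S : R) : (spl Y < S%:E)%E ->
  exists2 v : {linear Z -> Y}, ts_section v & forall z, `|v z| <= S * `|z|.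
Proof.
move=> /ereal_inf_lt[_ [v vs <-]]; rewrite lte_fin => /ltW vS; exists v => // z.
apply: le_trans (opnormP vs.1 z) _; apply: ler_wpM2r => //; apply: le_trans vS.
rewrite -[leLHS]ger0_norm ?opnorm_ge0// -sqrtr_sqr ler_wsqrtr//.
by rewrite lerDl sqr_ge0.
Qed.

End SplittingConstant.

(** * Uniform extension constants and finite dimensional targets *)

Section UniformExtension.
Variables (R : realType) (E F : completeNormedModType R) (Q : {linear F -> E}).
Local Notation X := (submod_type (linker Q)).

Lemma insub_ord_inj n (i i' : nat) (j : 'I_n) :
  insub i = Some j -> insub i' = Some j -> i = i'.
Proof. by case: insubP => // j0 _ <- [->]; case: insubP => // j1 _ <- [->]. Qed.

(** The operators [w], padded with zeros, are pointwise bounded in \ell^2. Their coordinatewise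
    limit along an ultrafilter on nat is linear and keeps the bound, and on the kernel coordinate i
    is constant for n >= i. *)
Lemma extends_limit (u : {linear X -> ell2 R nat}) (M : R) : 0 <= M ->
  (forall n, exists w : {linear F -> ell2 R 'I_n.+1},
    (forall (x : X) i, w (val x) i = u x i) /\ (forall f, `|w f| <= M * `|f|)) ->
  extends u M.
Proof.
move=> M0 wn.
have {}wn n : exists w : F -> ell2 R nat,
    [/\ linear w, forall (x : X) i, (i <= n)%N -> w (val x) i = u x i &
    forall f, `|w f| <= M * `|f|].
  have [w [wu wM]] := wn n; have [J JC JE] := @ell2_pull R _ _ _ (@insub_ord_inj n.+1).
  exists (fun f => J (w f)); split => [a f g|x i lein|f].
  - by rewrite !linearP.
  - by rewrite JE insubT /= wu.
  - exact: le_trans (JC _) (wM f).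
have [v vP] := choice wn.
have [U [UU Uoo]] := ultraFilterLemma (@eventually_filter).
have Up : ProperFilter U by exact: ultra_proper.
have lim f : exists l : ell2 R nat, `|l| <= M * `|f| /\
    forall i, v n f i @[n --> U] --> l i.
  have [||l lM lP] := @ultra_ell2_cvg R _ U UU nat (fun n => v n f) (M * `|f|).
  - by rewrite mulr_ge0.
  - by apply: nearW => n; have [_ _] := vP n.
  - by exists l.
have [l lP] := choice lim.
have ll : linear l.
  move=> a f g; apply: val_inj; apply/funext => i.
  apply: (cvg_unique _ ((lP (a *: f + g)).2 i)); first exact: Rhausdorff.
  rewrite (_ : (fun n => _) = (fun n => a * v n f i + v n g i)).
    apply: cvgD; last exact: (lP g).2.
    by apply: cvgM; [exact: cvg_cst|exact: (lP f).2].
  by apply/funext => n; have [vl _ _] := vP n; rewrite vl.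
have [w0 wE] := linear_pack ll; exists w0; split=> [x|f]; rewrite wE; last exact: (lP f).1.
apply: val_inj; apply/funext => i.
apply: (cvg_unique _ ((lP (val x)).2 i)); first exact: Rhausdorff.
apply: cvg_trans; last exact: (@cvg_cst _ _ _ U).
apply: near_eq_cvg.
suff : U [set n | u x i = v n (val x) i] by [].
by apply: Uoo; exists i => // n /= ni; have [_ -> ] := vP n.
Qed.

Lemma extends_scale (I : choiceType) (u : {linear X -> ell2 R I}) (C a : R) :
  0 < a ->
  (forall u : {linear X -> ell2 R I}, (forall x, `|u x| <= `|x|) -> extends u C) ->
  (forall x, `|u x| <= a * `|x|) -> extends u (a * C).
Proof.
move=> a0 uni ua.
have [x|w [wu wC]] := uni (a^-1 \*: u).
  by rewrite /= normrZ gtr0_norm ?invr_gt0// ler_pdivrMl.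
exists (a \*: w); split=> [x|f] /=.
  by rewrite wu /= scalerA divff ?gt_eqF// scale1r.
by rewrite normrZ gtr0_norm// -mulrA ler_pM2l.
Qed.

Lemma extends_ord n (u : {linear X -> ell2 R 'I_n}) (C : R) :
  (forall u : {linear X -> ell2 R nat}, (forall x, `|u x| <= `|x|) -> extends u C) ->
  (forall x, `|u x| <= `|x|) -> extends u C.
Proof.
move=> uni uc.
have [J JC JE] := @ell2_pull R _ _ _ (@insub_ord_inj n).
have [P PC PE] := @ell2_pull R 'I_n nat (fun i => Some (val i))
  (fun i j k => ltac:(by move=> [<-] [/val_inj ->])).
have [x|w [wu wC]] := uni (J \o u); first exact: le_trans (JC _) (uc x).
exists (P \o w); split => [x|f] /=.
  by rewrite wu; apply: val_inj; apply/funext => i; rewrite /= PE JE valK.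
exact: le_trans (PC _) (wC f).
Qed.

(** The squared weights [4 ^- k] sum to 4 / 3, which is at most [2 ^+ 2]. *)
Lemma sqsum_blocks (a : nat -> nat -> R) (c : R) : 0 <= c ->
  (forall k (s : seq nat), uniq s -> \sum_(i <- s) a k i ^+ 2 <= c ^+ 2) ->
  forall s : seq (nat * nat), uniq s ->
  \sum_(p <- s) (2^-1 ^+ p.1 * a p.1 p.2) ^+ 2 <= (2 * c) ^+ 2.
Proof.
move=> c0 ac s us; pose K := (\max_(p <- s) p.1).+1.
have sK p : p \in s -> (p.1 < K)%N by move=> ps; rewrite ltnS; exact: leq_bigmax_seq.
have -> : \sum_(p <- s) (2^-1 ^+ p.1 * a p.1 p.2) ^+ 2 =
    \sum_(k < K) \sum_(p <- s | p.1 == k) (2^-1 ^+ k * a k p.2) ^+ 2.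
  rewrite (exchange_big_dep predT)//= big_seq [RHS]big_seq.
  apply: eq_bigr => p /sK pK; rewrite (bigD1 (Ordinal pK))//= big1 ?addr0//.
  by move=> k /andP[/eqP pk]; rewrite -val_eqE /= pk eqxx.
apply: (@le_trans _ _ (\sum_(k < K) c ^+ 2 * (4^-1) ^+ k)).
  apply: ler_sum => k _.
  under eq_bigr do rewrite exprMn.
  rewrite -mulr_sumr -exprM mulnC exprM (_ : 2^-1 ^+ 2 = 4^-1); last by field.
  rewrite mulrC; apply: ler_wpM2r; first by rewrite exprn_ge0// invr_ge0.
  rewrite -big_filter -(big_map snd predT (fun i => a k i ^+ 2)); apply: ac.
  rewrite map_inj_in_uniq ?filter_uniq// => -[k1 i1] [k2 i2].
  by rewrite !mem_filter/= => /andP[/eqP-> _] /andP[/eqP-> _] ->.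
rewrite -mulr_sumr exprMn mulrC; apply: ler_wpM2r; first exact: sqr_ge0.
have -> : \sum_(k < K) 4^-1 ^+ k = series (geometric 1 (4^-1 : R)) K.
  by rewrite /series/= big_mkord; apply: eq_bigr => k _; rewrite mul1r.
apply: le_trans (@geometric_le_lim _ _ _ _ _ _ _) _ => //.
  by rewrite ger0_norm// invf_lt1// ltr1n.
rewrite mul1r -[leRHS]invrK lef_pV2 ?posrE; lra.
Qed.

(** If no constant works, take contractions u k without extension of bound [4 ^+ k]. Their sum with
    weights 2^-k has an extension of some bound M; its block k, multiplied by [2 ^+ k], extends u k
    with bound [2 ^+ k * M], a contradiction once [M <= 2 ^+ k]. *)
Lemma uniform_extends :
  (forall u : {linear X -> ell2 R nat}, continuous u -> exists M, extends u M) ->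
  exists2 C : R, 0 < C & forall u : {linear X -> ell2 R nat},
    (forall x, `|u x| <= `|x|) -> extends u C.
Proof.
move=> ext; apply: contrapT => nC.
have bad k : exists u : {linear X -> ell2 R nat},
    (forall x, `|u x| <= `|x|) /\ ~ extends u (4 ^+ k).
  apply: contrapT => /forallNP nu; apply: nC; exists (4 ^+ k); first exact: exprn_gt0.
  by move=> u uc; apply: contrapT => nue; apply: (nu u).
have [u uP] := choice bad.
pose v x (p : nat * nat) : R := 2^-1 ^+ p.1 * u p.1 x p.2.
have vle x : forall s, uniq s -> \sum_(p <- s) v x p ^+ 2 <= (2 * `|x|) ^+ 2.
  apply: (@sqsum_blocks (fun k i => u k x i)) => // k; apply/ell2_norm_leP => //.
  exact: (uP k).1.
have vmem x : v x \in @ell2_pred R (nat * nat)%type.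
  by rewrite inE; apply: le_lt_trans (ltry ((2 * `|x|) ^+ 2)); apply/sqsum_leP; exact: vle.
have [V VE] : exists V : {linear X -> ell2 R (nat * nat)%type},
    V =1 (fun x => Ell2 (vmem x)).
  apply: linear_pack => a x y; apply: val_inj; apply/funext => p.
  rewrite /= /v linearP -[RHS]/(a * v x p + v y p) /v.
  rewrite -[(a *: u p.1 x + u p.1 y : ell2 R nat) p.2]/(a * u p.1 x p.2 + u p.1 y p.2).
  ring.
have VC x : `|V x| <= 2 * `|x|.
  by rewrite VE; apply/ell2_norm_leP; [rewrite mulr_ge0|exact: vle].
have [P PC PE] := @ell2_pull R nat (nat * nat)%type pickle_inv
  (fun i j p => ltac:(move=> ip jp; have := @pickle_invK (nat * nat)%type i;
     have := @pickle_invK (nat * nat)%type j; rewrite ip jp /= => <- <- //)).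
have [|M [w [wu wM]]] := ext (P \o V).
  by apply: (@bounded_linear_cont _ _ _ _ 2) => x; exact: le_trans (PC _) (VC x).
have [k Mk] : exists k, M <= 2 ^+ k.
  exists (Num.truncn M).+1; apply: le_trans (ltW (truncnS_gt _)) _.
  by rewrite -natrX ler_nat ltnW// ltn_expl.
have [P' PC' PE'] := @ell2_pull R nat nat (fun i => Some (pickle (k, i)))
  (fun i j p => ltac:(by move=> [<-] [/(pcan_inj pickleK)[->]])).
apply: (uP k).2; exists (2 ^+ k \*: (P' \o w)); split=> [x|f] /=.
  apply: val_inj; apply/funext => i.
  rewrite -[LHS]/(2 ^+ k * P' (w (val x)) i) PE' wu /= PE pickleK_inv VE /= /v /=.
  by rewrite mulrA -exprMn divff// expr1n mul1r.
rewrite normrZ ger0_norm ?exprn_ge0// (_ : 4 = 2 * 2); last by ring.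
rewrite exprMn -mulrA ler_pM2l ?exprn_gt0//; apply: le_trans (PC' _) _.
by apply: le_trans (wM f) _; apply: ler_wpM2r.
Qed.

End UniformExtension.

(** * Grothendieck's inequality *)

Lemma ler_sum_subset (R : numDomainType) (T : eqType) (s s' : seq T) (f : T -> R) :
  uniq s -> uniq s' -> {subset s <= s'} -> (forall k, 0 <= f k) ->
  \sum_(k <- s) f k <= \sum_(k <- s') f k.
Proof.
move=> us us' ss' f0; rewrite [leRHS](bigID (mem s))/=.
have -> : \sum_(k <- s' | k \in s) f k = \sum_(k <- s) f k.
  rewrite -big_filter; apply: perm_big; apply: uniq_perm; rewrite ?filter_uniq//.
  move=> k; rewrite mem_filter.
  by apply/andP/idP => [[]|ks] //; split=> //; exact: ss'.
by rewrite lerDl; apply: sumr_ge0.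
Qed.

Section GrothendieckInequality.
Variable R : realType.

(** Independent signs on a finite set with counting measure. Adding a sign turns the mean of f^4
    into that of a^4 + 6 a^2 f^2 + f^4, which preserves the constant 3 of the fourth moment. *)
Lemma rademacher (T : eqType) (s : seq T) : uniq s ->
  exists (Xi : finType) (r : Xi -> T -> R), (0 < #|Xi|)%N /\
  forall x y : T -> R,
    \sum_o (\sum_(k <- s) x k * r o k) * (\sum_(k <- s) y k * r o k) =
      #|Xi|%:R * \sum_(k <- s) x k * y k /\
    \sum_o (\sum_(k <- s) x k * r o k) ^+ 4 <=
      #|Xi|%:R * (3 * (\sum_(k <- s) x k ^+ 2) ^+ 2).
Proof.
elim: s => [_|t s IH /= /andP[ts /IH[Xi [r [Xi0 rP]]]]].
  exists unit, (fun _ _ => 0); rewrite card_unit; split => // x y.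
  under eq_bigr do rewrite !big_nil mulr0.
  under [X in _ /\ X <= _]eq_bigr do rewrite big_nil expr0n.
  by rewrite !big_nil !big1_eq expr0n/= !mulr0.
pose sg (b : bool) : R := if b then 1 else -1.
exists (Xi * bool)%type, (fun o k => if k == t then sg o.2 else r o.1 k).
rewrite card_prod card_bool muln_gt0 Xi0; split=> // x y.
pose f z o := \sum_(k <- s) z k * r o k.
have fE z (o : Xi * bool) :
    \sum_(k <- t :: s) z k * (if k == t then sg o.2 else r o.1 k) =
    z t * sg o.2 + f z o.1.
  rewrite big_cons eqxx; congr (_ + _); rewrite big_seq [RHS]big_seq.
  by apply: eq_bigr => k ks; case: eqP ks ts => // -> ->.
have sumE (g : Xi * bool -> R) : \sum_o g o = \sum_o (g (o, true) + g (o, false)).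
  transitivity (\sum_o \sum_b g (o, b)).
    by rewrite pair_bigA; apply: eq_bigr => -[].
  by apply: eq_bigr => o _; rewrite big_bool.
have [fxy f4] := rP x y; have [fxx _] := rP x x.
have -> : (#|Xi| * 2)%:R = #|Xi|%:R * 2 :> R by rewrite natrM.
split.
  under eq_bigr do rewrite !fE.
  rewrite sumE /= /sg big_cons.
  have -> : \sum_o ((x t * 1 + f x o) * (y t * 1 + f y o) +
      (x t * -1 + f x o) * (y t * -1 + f y o)) =
      \sum_o (2 * (x t * y t) + 2 * (f x o * f y o)).
    by apply: eq_bigr => o _; ring.
  rewrite big_split/= sumr_const -mulr_sumr fxy -[_ *+ #|_|]mulr_natr; ring.
under eq_bigr do rewrite !fE.
rewrite sumE /= /sg big_cons.
have -> : \sum_o ((x t * 1 + f x o) ^+ 4 + (x t * -1 + f x o) ^+ 4) =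
    \sum_o (2 * x t ^+ 4 + 12 * x t ^+ 2 * (f x o * f x o) + 2 * (f x o) ^+ 4).
  by apply: eq_bigr => o _; ring.
rewrite !big_split/= sumr_const -!mulr_sumr fxx -[_ *+ #|_|]mulr_natr.
have -> : \sum_(k <- s) x k * x k = \sum_(k <- s) x k ^+ 2 by [].
move: f4; set n := (#|Xi|%:R : R); set S := \sum_(k <- s) x k ^+ 2 => f4.
have n0 : 0 <= n by [].
have := mulr_ge0 n0 (sqr_ge0 (x t ^+ 2)); rewrite -exprM => H.
have -> : n * 2 * (3 * (x t ^+ 2 + S) ^+ 2) =
  n * 6 * x t ^+ 4 + 12 * x t ^+ 2 * (n * S) + 2 * (n * (3 * S ^+ 2)) by ring.
have := f4; rewrite -/(f x); lra.
Qed.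

Let trunc2 (z : R) : R := Num.max (-2) (Num.min 2 z).
Let rest2 (z : R) : R := z - trunc2 z.

Let trunc2_bound z : `|2^-1 * trunc2 z| <= 1.
Proof.
rewrite ler_norml /trunc2.
have [] := leP 2 z; have [] := leP (-2) z; have [] := leP (-2) (2 : R); lra.
Qed.

Let trunc2_sqr z : trunc2 z ^+ 2 <= z ^+ 2.
Proof.
rewrite /trunc2; have [] := leP 2 z; have [] := leP (-2) z; have [] := leP (-2) (2 : R); nra.
Qed.

(** Since (|z| - 4)^2 >= 0, the excess |z| - 2 is at most z^2 / 8. The factor 4 is affordable: with
    fourth moment at most 3, [4 * rest2] has second moment at most 3 / 4. *)
Let rest2_sqr z : (4 * rest2 z) ^+ 2 <= z ^+ 4 / 4.
Proof.
have sq w : 0 <= w -> w <= z ^+ 2 / 2 -> w ^+ 2 <= z ^+ 4 / 4.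
  move=> w0 wz; rewrite (_ : z ^+ 4 / 4 = (z ^+ 2 / 2) ^+ 2); last by field.
  by rewrite lerXn2r ?nnegrE// (le_trans w0 wz).
rewrite /rest2 /trunc2.
have [z2|z2] := leP 2 z.
  rewrite max_r; last by lra.
  apply: sq; first by lra.
  have := sqr_ge0 (z - 4); rewrite expr2 => ?; rewrite expr2; lra.
have [z3|z3] := leP (-2) z.
  by rewrite subrr mulr0 expr0n; apply: divr_ge0 => //; exact: exprn_even_ge0.
rewrite -sqrrN; apply: sq; first by lra.
have := sqr_ge0 (z + 4); rewrite expr2 => ?; rewrite expr2; lra.
Qed.

Variables (I J : finType) (a : I -> J -> R) (A : R).
Hypothesis aA : forall (s : I -> R) (t : J -> R),
  (forall i, `|s i| <= 1) -> (forall j, `|t j| <= 1) ->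
  \sum_i \sum_j a i j * (s i * t j) <= A.

(** The coordinate set varies, so that random variables on a finite set are again admissible
    vectors. *)
Let values : set R := [set v | exists (T : eqType) (K : seq T)
    (x : I -> T -> R) (y : J -> T -> R),
  [/\ uniq K, forall i, \sum_(k <- K) x i k ^+ 2 <= 1,
      forall j, \sum_(k <- K) y j k ^+ 2 <= 1 &
      v = \sum_i \sum_j a i j * \sum_(k <- K) x i k * y j k]].

(* Replace the vectors by the Gaussian-like random variables                  *)
(* f = \sum_k x k * r k and truncate these at 2; the remainders have          *)
(* L^2-norm at most 1 / 4 by the fourth moment bound, hence contribute at     *)
(* most half of the supremum which is being estimated.                        *)
Let values_improve v : values v -> v <= 4 * A + sup values / 2.
Proof.
have vub : has_ubound values.
  exists (\sum_i \sum_j `|a i j|) => _ [T [K [x [y [_ x1 y1 ->]]]]].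
  apply: ler_sum => i _; apply: ler_sum => j _.
  apply: le_trans (ler_norm _) _; rewrite normrM -[leRHS]mulr1 ler_wpM2l//.
  (* Used for s = 1 and s = -1, this gives the Cauchy-Schwarz bound that makes the supremum
     finite. *)
  have key (s : R) : s ^+ 2 = 1 -> s * (\sum_(k <- K) x i k * y j k) <= 1.
    move=> s1; have : 0 <= \sum_(k <- K) (x i k - s * y j k) ^+ 2.
      by apply: sumr_ge0 => k _; exact: sqr_ge0.
    have -> : \sum_(k <- K) (x i k - s * y j k) ^+ 2 =
        \sum_(k <- K) (x i k ^+ 2 + y j k ^+ 2 - 2 * s * (x i k * y j k)).
      by apply: eq_bigr => k _; rewrite sqrrB exprMn s1 mul1r; ring.
    by rewrite sumrB big_split/= -mulr_sumr; have := x1 i; have := y1 j; lra.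
  rewrite ler_norml; have := key 1; have := key (-1); rewrite sqrrN expr1n.
  by move=> /(_ erefl) ? /(_ erefl); lra.
move=> [T [K [x [y [uK x1 y1 ->]]]]].
have [Xi [r [Xi0 rP]]] := rademacher uK.
pose f i o := \sum_(k <- K) x i k * r o k.
pose g j o := \sum_(k <- K) y j k * r o k.
set N : R := #|Xi|%:R in rP.
have N0 : 0 < N by rewrite ltr0n.
(* This factor normalizes the counting measure, so that [c * f] has as Euclidean norm the L^2-norm
   of f. *)
pose c := (Num.sqrt N)^-1.
have c2 : c ^+ 2 = N^-1 by rewrite exprVn sqr_sqrtr// ltW.
have f2 i : \sum_o (c * f i o) ^+ 2 <= 1.
  under eq_bigr do rewrite exprMn c2.
  rewrite -mulr_sumr ler_pdivrMl// mulr1 (rP (x i) (x i)).1 -[leRHS]mulr1.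
  by rewrite ler_pM2l// x1.
have g2 j : \sum_o (c * g j o) ^+ 2 <= 1.
  under eq_bigr do rewrite exprMn c2.
  rewrite -mulr_sumr ler_pdivrMl// mulr1 (rP (y j) (y j)).1 -[leRHS]mulr1.
  by rewrite ler_pM2l// y1.
have rest1 (z : T -> R) : \sum_(k <- K) z k ^+ 2 <= 1 ->
    \sum_o (c * (4 * rest2 (\sum_(k <- K) z k * r o k))) ^+ 2 <= 1.
  move=> z1; under eq_bigr do rewrite exprMn c2.
  rewrite -mulr_sumr ler_pdivrMl// mulr1.
  apply: (@le_trans _ _ (\sum_o (\sum_(k <- K) z k * r o k) ^+ 4 / 4)).
    by apply: ler_sum => o _; exact: rest2_sqr.
  rewrite -mulr_suml ler_pdivrMr//; apply: le_trans (rP z z).2 _.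
  rewrite ler_pM2l//; have z0 : 0 <= \sum_(k <- K) z k ^+ 2.
    by apply: sumr_ge0 => k _; exact: sqr_ge0.
  nra.
have f1 i : \sum_o (c * trunc2 (f i o)) ^+ 2 <= 1.
  apply: le_trans (f2 i); apply: ler_sum => o _.
  by rewrite !exprMn ler_wpM2l ?sqr_ge0//; exact: trunc2_sqr.
have v1 : \sum_i \sum_j a i j * \sum_o (c * (4 * rest2 (f i o))) * (c * g j o)
    <= sup values.
  apply: ub_le_sup => //; exists Xi, (index_enum Xi).
  exists (fun i o => c * (4 * rest2 (f i o))), (fun j o => c * g j o); split=> //.
  - exact: index_enum_uniq.
  - by move=> i; exact: rest1.
have v2 : \sum_i \sum_j a i j * \sum_o (c * trunc2 (f i o)) * (c * (4 * rest2 (g j o)))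
    <= sup values.
  apply: ub_le_sup => //; exists Xi, (index_enum Xi).
  exists (fun i o => c * trunc2 (f i o)), (fun j o => c * (4 * rest2 (g j o))); split=> //.
  - exact: index_enum_uniq.
  - by move=> j; exact: rest1.
(* For fixed o the halved truncations lie in [-1, 1], so the scalar hypothesis [aA] applies; then
   average over o. *)
have v3 : \sum_i \sum_j a i j *
    \sum_o N^-1 * ((2^-1 * trunc2 (f i o)) * (2^-1 * trunc2 (g j o))) <= A.
  have -> : \sum_i \sum_j a i j *
      \sum_o N^-1 * ((2^-1 * trunc2 (f i o)) * (2^-1 * trunc2 (g j o))) =
      N^-1 * \sum_o \sum_i \sum_j
        a i j * ((2^-1 * trunc2 (f i o)) * (2^-1 * trunc2 (g j o))).
    rewrite [in RHS]exchange_big/= [RHS]mulr_sumr; apply: eq_bigr => i _.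
    rewrite [in RHS]exchange_big/= [RHS]mulr_sumr; apply: eq_bigr => j _.
    by rewrite !mulr_sumr; apply: eq_bigr => o _; rewrite mulrCA.
  rewrite ler_pdivrMl// /N -sum1_card natr_sum mulr_suml.
  by apply: ler_sum => o _; rewrite mul1r; apply: aA => ?; exact: trunc2_bound.
(* The product f g splits as (trunc f)(trunc g) + (rest f) g + (trunc f)(rest g); the outer factors
   undo the halvings and the factor 4 of the remainders. *)
have -> : \sum_i \sum_j a i j * \sum_(k <- K) x i k * y j k =
  4 * (\sum_i \sum_j a i j * \sum_o N^-1 * ((2^-1 * trunc2 (f i o)) * (2^-1 * trunc2 (g j o)))) +
  (4^-1 * (\sum_i \sum_j a i j * \sum_o (c * (4 * rest2 (f i o))) * (c * g j o)) +
   4^-1 * (\sum_i \sum_j a i j * \sum_o (c * trunc2 (f i o)) * (c * (4 * rest2 (g j o))))).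
  rewrite !mulr_sumr -!big_split/=; apply: eq_bigr => i _.
  rewrite !mulr_sumr -!big_split/=; apply: eq_bigr => j _.
  rewrite !(mulrCA _ (a i j)) -!mulrDr; congr (_ * _).
  rewrite !mulr_sumr -!big_split/=.
  rewrite (_ : \sum_(k <- K) x i k * y j k = N^-1 * \sum_o f i o * g j o); last first.
    by rewrite (rP (x i) (y j)).1 mulKf// gt_eqF.
  rewrite !mulr_sumr -!big_split; apply: eq_bigr => o _ /=.
  by rewrite -c2 /rest2; field.
lra.
Qed.

(** By [values_improve] the supremum s satisfies s <= 4 A + s / 2, hence s <= 8 A. *)
Lemma grothendieck_inequality (T : eqType) (K : seq T) (x : I -> T -> R) (y : J -> T -> R) :
  uniq K -> (forall i, \sum_(k <- K) x i k ^+ 2 <= 1) ->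
  (forall j, \sum_(k <- K) y j k ^+ 2 <= 1) ->
  \sum_i \sum_j a i j * \sum_(k <- K) x i k * y j k <= 8 * A.
Proof.
move=> uK x1 y1.
have vx : values (\sum_i \sum_j a i j * \sum_(k <- K) x i k * y j k).
  by exists T, K, x, y.
have : sup values <= 4 * A + sup values / 2.
  apply: ge_sup; last exact: values_improve.
  by exists (\sum_i \sum_j a i j * \sum_(k <- K) x i k * y j k).
by have := values_improve vx; lra.
Qed.

Lemma ell2_norm_approx (L : choiceType) (z : ell2 R L) (e : R) : 0 < e ->
  exists2 K : seq L, uniq K & `|z| - e < Num.sqrt (\sum_(k <- K) z k ^+ 2).
Proof.
move=> e0; apply: contrapT => nK.
have leK K : uniq K -> Num.sqrt (\sum_(k <- K) z k ^+ 2) <= `|z| - e.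
  by move=> uK; rewrite leNgt; apply/negP => ?; apply: nK; exists K.
have ze : 0 <= `|z| - e by apply: le_trans (leK [::] isT); exact: sqrtr_ge0.
suff : `|z| <= `|z| - e by lra.
apply/ell2_norm_leP => // K uK; rewrite -[leLHS]sqr_sqrtr.
  by rewrite lerXn2r ?nnegrE ?sqrtr_ge0 ?leK.
by apply: sumr_ge0 => k _; exact: sqr_ge0.
Qed.

(** The norm of each sum is tested against its own normalization, cut to a finite set of coordinates
    common to all i; the total loss is at most e. *)
Lemma grothendieck_ell2 (L : choiceType) (y : J -> ell2 R L) :
  (forall j, `|y j| <= 1) -> \sum_i `|\sum_j a i j *: y j| <= 8 * A.
Proof.
move=> y1; apply/ler_addgt0Pr => e e0.
pose z i := \sum_j a i j *: y j.
have zE i k : z i k = \sum_j a i j * y j k.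
  exact: (@big_morph _ _ (fun h : ell2 R L => h k) 0 +%R).
pose d := e / #|I|.+1%:R.
have d0 : 0 < d by rewrite divr_gt0.
have approx i : exists K : seq L, uniq K /\ `|z i| - d < Num.sqrt (\sum_(k <- K) z i k ^+ 2).
  by have [K ? ?] := ell2_norm_approx (z i) d0; exists K.
have [K_ K_P] := choice approx.
pose K := undup (flatten [seq K_ i | i <- enum I]).
have uK : uniq K by exact: undup_uniq.
have KK i : {subset K_ i <= K}.
  move=> k ki; rewrite mem_undup; apply/flattenP; exists (K_ i) => //.
  by apply: map_f; rewrite mem_enum.
pose n i := Num.sqrt (\sum_(k <- K) z i k ^+ 2).
have zn i : `|z i| <= n i + d.
  rewrite -lerBlDr; apply: le_trans (ltW (K_P i).2) _; apply: ler_wsqrtr.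
  apply: ler_sum_subset => //; first exact: (K_P i).1.
  by move=> k; exact: sqr_ge0.
have n2 i : n i ^+ 2 = \sum_(k <- K) z i k ^+ 2.
  by rewrite sqr_sqrtr//; apply: sumr_ge0 => k _; exact: sqr_ge0.
apply: (@le_trans _ _ (\sum_i (n i + d))); first by apply: ler_sum => i _; exact: zn.
rewrite big_split/= sumr_const; apply: lerD; last first.
  by rewrite -mulr_natr /d -mulrA ler_piMr ?(ltW e0)// mulrC ler_pdivrMr// mul1r ler_nat.
(* If [n i] is 0, then so is [z i k / n i], and the identity persists. *)
have -> : \sum_i n i = \sum_i \sum_j a i j * \sum_(k <- K) (z i k / n i) * y j k.
  apply: eq_bigr => i _.
  transitivity (\sum_(k <- K) z i k ^+ 2 / n i).
    rewrite -mulr_suml -n2 expr2; have [->|ni] := eqVneq (n i) 0.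
      by rewrite !mul0r.
    by rewrite mulfK.
  under eq_bigr do rewrite expr2 {2}zE mulr_sumr mulr_suml.
  rewrite exchange_big/=; apply: eq_bigr => j _.
  by rewrite mulr_sumr; apply: eq_bigr => k _; ring.
apply: grothendieck_inequality => // [i|j].
  under eq_bigr do rewrite expr_div_n.
  rewrite -mulr_suml -n2; have [->|ni] := eqVneq (n i) 0.
    by rewrite expr0n mul0r.
  by rewrite divff// expf_neq0.
apply: le_trans (ell2_norm_sum _ uK) _.
rewrite expr_le1 ?ell2_norm_ge0//; exact: y1.
Qed.

End GrothendieckInequality.

(** * Summing operators *)

Section SummingOfExtends.
Variables (R : realType) (E F : completeNormedModType R) (Q : {linear F -> E}).
Local Notation X := (submod_type (linker Q)).

Lemma dual_ball_norm (V : normedModType R) (f : {linear V -> R^o}) x :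
  dual_ball V f -> `|f x| <= `|x|.
Proof.
move=> [fc f1]; apply: le_trans (opnormP fc x) _.
by rewrite -[leRHS]mul1r ler_wpM2r.
Qed.

Lemma dual_ball_mem (V : normedModType R) (f : {linear V -> R^o}) :
  (forall x, `|f x| <= `|x|) -> dual_ball V f.
Proof.
move=> f1; split; first by apply: (@bounded_linear_cont _ _ _ _ 1) => x; rewrite mul1r.
by apply: opnorm_le => // x; rewrite mul1r.
Qed.

Definition weak_sums (V : normedModType R) n (x : 'I_n -> V) : set R :=
  [set \sum_i `|f (x i)| | f in dual_ball V].

Lemma weak_sums_ub (V : normedModType R) n (x : 'I_n -> V) :
  has_ubound (weak_sums x).
Proof.
exists (\sum_i `|x i|) => _ [f f1 <-].
by apply: ler_sum => i _; exact: dual_ball_norm.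
Qed.

Lemma weak_sums_neq0 (V : normedModType R) n (x : 'I_n -> V) : weak_sums x !=set0.
Proof.
exists (\sum_(i < n) `|(\0 : {linear V -> R^o}) (x i)|), \0 => //.
by apply: dual_ball_mem => y; rewrite normr0.
Qed.

(** Grothendieck's inequality is applied to the matrix of local coordinates of the x i. Its scalar
    bound is C times the weak sum, because a combination of coordinates with coefficients in [-1, 1]
    is a functional of norm at most C. *)
Lemma summing_of_extends (u : {linear X -> ell2 R nat}) (M : R) :
  L1_space F -> extends u M -> absolutely_summing u.
Proof.
move=> FL1 [w [wu wM]]; have [C C0 loc] := L1_local_coordinates FL1.
pose M' := `|M| + 1; have M0 : 0 < M' by rewrite /M' ltr_wpDl.
have wM' f : `|w f| <= M' * `|f|.
  by apply: le_trans (wM f) _; rewrite ler_wpM2r// (le_trans (ler_norm M))// lerDl.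
exists (M' * (8 * C)) => n x.
have [H [m [t [b [sH tl tb b1 tC]]]]] := loc [seq val (x i) | i <- enum 'I_n].
have xH i : val (x i) \in H by apply: sH; apply: map_f; rewrite mem_enum.
pose y j := M'^-1 *: w (b j).
have y1 j : `|y j| <= 1.
  rewrite normrZ gtr0_norm ?invr_gt0// ler_pdivrMl// mulr1.
  by apply: le_trans (wM' _) _; rewrite b1 mulr1.
have uE i : u (x i) = M' *: \sum_j t (val (x i)) j *: y j.
  rewrite -wu {1}(tb _ (xH i)) linear_sum/= scaler_sumr; apply: eq_bigr => j _.
  by rewrite linearZ/= /y !scalerA mulrAC divff ?gt_eqF// mul1r.
have -> : \sum_i `|u (x i)| = M' * \sum_i `|\sum_j t (val (x i)) j *: y j|.
  by rewrite mulr_sumr; apply: eq_bigr => i _; rewrite uE normrZ gtr0_norm.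
rewrite -mulrA ler_pM2l// -mulrA.
apply: (@grothendieck_ell2 _ _ _ (fun i j => t (val (x i)) j)) => // sg th sg1 th1.
(* The coordinates are linear only on H, so the functional lives on the part of X in H and is
   extended to X, whose dual ball defines the weak sum. *)
pose D := [set z : X | val z \in H].
pose phi (z : X) : R := \sum_j t (val z) j * th j.
have [||||||f [fD fC]] := @hahn_banach R X (fun z => C * `|z|) _ _ D phi.
- by move=> z z'; rewrite -mulrDr ler_pM2l// ler_normD.
- by move=> a z a0; rewrite normrZ gtr0_norm// mulrCA.
- by rewrite /D /mkset linear0 rpred0.
- by move=> a z z'; rewrite /D /mkset => zH z'H; rewrite linearP rpredD// rpredZ.
- move=> a z z' zH z'H; rewrite /phi mulr_sumr -big_split; apply: eq_bigr => j _.
  by rewrite linearP tl// mulrDl mulrA.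
- move=> z zH; apply: le_trans (tC _ zH); apply: ler_sum => j _.
  apply: le_trans (ler_norm _) _; rewrite normrM -[leRHS]mulr1.
  by rewrite ler_wpM2l.
have fC' z : `|f z| <= C * `|z|.
  by rewrite ler_norml fC andbT lerNl -linearN -normrN fC.
have gB : dual_ball X (C^-1 \*: f).
  apply: dual_ball_mem => z.
  by rewrite /= normrZ gtr0_norm ?invr_gt0// ler_pdivrMl.
rewrite -ler_pdivrMl//.
apply: (@le_trans _ _ (\sum_i `|(C^-1 \*: f) (x i)|)); last first.
  by apply: (ub_le_sup (weak_sums_ub x)); exists (C^-1 \*: f).
rewrite mulr_sumr; apply: ler_sum => i _ /=.
rewrite normrZ gtr0_norm ?invr_gt0// ler_pM2l ?invr_gt0// fD; last exact: xH.
under eq_bigr do rewrite mulrCA.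
rewrite -mulr_sumr; apply: le_trans (ler_norm _) _.
by rewrite normrM -[leRHS]mul1r ler_wpM2r.
Qed.

End SummingOfExtends.

(** * Orthonormalization for a positive semidefinite form *)

Section GramSchmidt.
Variables (R : realType) (V : lmodType R) (q : V -> V -> R).
Hypotheses (qC : forall x y, q x y = q y x).
Hypothesis qP : forall a x y z, q (a *: x + y) z = a * q x z + q y z.
Hypothesis q_ge0 : forall x, 0 <= q x x.

Let q0l z : q 0 z = 0.
Proof. by have := qP 1 0 0 z; rewrite scaler0 addr0; lra. Qed.

Let qD x y z : q (x + y) z = q x z + q y z.
Proof. by have := qP 1 x y z; rewrite scale1r mul1r. Qed.

Let qZ a x z : q (a *: x) z = a * q x z.
Proof. by have := qP a x 0 z; rewrite addr0 q0l addr0. Qed.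

Let qB x y z : q (x - y) z = q x z - q y z.
Proof. by rewrite qD -scaleN1r qZ mulN1r. Qed.

Let q_sum m (c : 'I_m -> R) (b : 'I_m -> V) z :
  q (\sum_i c i *: b i) z = \sum_i c i * q (b i) z.
Proof. by elim/big_rec2: _ => [|i y1 y2 _ <-]; rewrite ?q0l// qP. Qed.

Lemma psd_form_null x y : q x x = 0 -> q x y = 0.
Proof.
move=> qx; apply/eqP/negPn/negP => qxy.
(* This t makes the form equal to -1 at [t *: x + y]. *)
pose t := - (q y y + 1) / (2 * q x y).
have e : q (t *: x + y) (t *: x + y) = 2 * t * q x y + q y y.
  by rewrite qP [q x _]qC [q y _]qC !qP qx [q y x]qC; ring.
have e1 : 2 * t * q x y + q y y = - 1 by rewrite /t; field.
by have := q_ge0 (t *: x + y); rewrite e e1; lra.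
Qed.

Definition orthonormal m (b : 'I_m -> V) := forall i j, q (b i) (b j) = (i == j)%:R.

Definition residual m (b : 'I_m -> V) z := z - \sum_j q z (b j) *: b j.

Lemma orthonormal_sum m (b : 'I_m -> V) (c : 'I_m -> R) k : orthonormal b ->
  q (\sum_i c i *: b i) (b k) = c k.
Proof.
move=> bO; rewrite q_sum (bigD1 k)//= bO eqxx mulr1 big1 ?addr0// => i ik.
by rewrite bO (negPf ik) mulr0.
Qed.

Lemma orthonormal_sqr m (b : 'I_m -> V) (c : 'I_m -> R) : orthonormal b ->
  q (\sum_i c i *: b i) (\sum_i c i *: b i) = \sum_i c i ^+ 2.
Proof.
move=> bO; rewrite q_sum; apply: eq_bigr => i _.
by rewrite qC orthonormal_sum.
Qed.

Lemma residual_orth m (b : 'I_m -> V) z k : orthonormal b ->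
  q (residual b z) (b k) = 0.
Proof. by move=> bO; rewrite qB orthonormal_sum// subrr. Qed.

Lemma bessel m (b : 'I_m -> V) z : orthonormal b ->
  \sum_j q z (b j) ^+ 2 <= q z z.
Proof.
move=> bO; have := q_ge0 (residual b z).
have -> : q (residual b z) (residual b z) = q (residual b z) z.
  rewrite {2}/residual qC qB [q z _]qC -[RHS]subr0; congr (_ - _).
  by rewrite q_sum big1// => i _; rewrite [q (b i) _]qC residual_orth// mulr0.
rewrite qB q_sum subr_ge0.
by under eq_bigr => j _ do rewrite [q (b j) z]qC -expr2.
Qed.

(** The form may be degenerate, so residuals are only null vectors; such vectors are orthogonal to
    everything by [psd_form_null], and are not added to the system. *)
Lemma gram_schmidt (s : seq V) : exists m (b : 'I_m -> V),
  orthonormal b /\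
  forall z, z \in s -> q (residual b z) (residual b z) = 0.
Proof.
elim: s => [|z s [m [b [bO bs]]]].
  by exists 0, (fun=> 0); split => // -[].
pose r := residual b z.
have [r0|r0] := eqVneq (q r r) 0.
  exists m, b; split=> // y; rewrite inE => /orP[/eqP->//|]; exact: bs.
have rp : 0 < q r r by rewrite lt_neqAle eq_sym r0 q_ge0.
pose e := (Num.sqrt (q r r))^-1 *: r.
have sq : Num.sqrt (q r r) ^+ 2 = q r r by rewrite sqr_sqrtr.
have s0 : Num.sqrt (q r r) != 0 by rewrite gt_eqF// sqrtr_gt0.
have eb k : q e (b k) = 0 by rewrite qZ residual_orth// mulr0.
have re : q r e = Num.sqrt (q r r).
  by rewrite qC qZ -{2}sq expr2 mulKf.
have ee : q e e = 1 by rewrite {1}/e qZ re mulVf.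
pose b' (i : 'I_m.+1) := oapp b e (unlift ord0 i).
have b'0 : b' ord0 = e by rewrite /b' unlift_none.
have b'l i : b' (lift ord0 i) = b i by rewrite /b' liftK.
have b'O : orthonormal b'.
  move=> i j; case: (unliftP ord0 i) => [i'|] ->; case: (unliftP ord0 j) => [j'|] ->.
  - by rewrite !b'l bO (inj_eq (@lift_inj _ ord0)).
  - by rewrite b'l b'0 qC eb eq_sym (negPf (neq_lift _ _)).
  - by rewrite b'l b'0 eb (negPf (neq_lift _ _)).
  - by rewrite b'0 ee eqxx.
have res y : residual b' y = residual b y - q (residual b y) e *: e.
  rewrite /residual big_ord_recl b'0; under eq_bigr do rewrite b'l.
  rewrite qB q_sum [X in q y e - X]big1 ?subr0 ?opprD ?addrA 1?addrAC//.
  by move=> i _; rewrite [q (b i) e]qC eb mulr0.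
exists m.+1, b'; split=> // y; rewrite inE res => /orP[/eqP->|/bs y0].
  rewrite -/r re /e scalerA divff// scale1r subrr.
  exact: q0l.
by rewrite (psd_form_null e y0) scale0r subr0.
Qed.

End GramSchmidt.

(** * Extension of summing operators by trace duality *)

Section ExtendsOfSumming.
Variables (R : realType) (E F : completeNormedModType R) (Q : {linear F -> E}).
Local Notation X := (submod_type (linker Q)).

Lemma sum_cauchy_schwarz (T : Type) (s : seq T) (a x y : T -> R) :
  (forall k, 0 <= x k) -> (forall k, 0 <= y k) ->
  (forall k, a k ^+ 2 <= x k * y k) ->
  (\sum_(k <- s) a k) ^+ 2 <= (\sum_(k <- s) x k) * (\sum_(k <- s) y k).
Proof.
move=> x0 y0 axy; elim: s => [|k s IH]; first by rewrite !big_nil mul0r expr0n.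
have S0 : 0 <= \sum_(k <- s) x k by exact: sumr_ge0.
have Y0 : 0 <= \sum_(k <- s) y k by exact: sumr_ge0.
rewrite !big_cons; move: IH (axy k) (x0 k) (y0 k) S0 Y0.
move: (a k) (x k) (y k) (\sum_(_ <- s) a _) (\sum_(_ <- s) x _) (\sum_(_ <- s) y _).
move=> b u v A S W AW buv u0 v0 S0 W0.
have h : 2 * (b * A) <= u * W + S * v.
  have uW : 0 <= u * W + S * v by rewrite addr_ge0 ?mulr_ge0.
  apply: (@le_trans _ _ `|2 * (b * A)|); first exact: ler_norm.
  rewrite -[leRHS]ger0_norm// -ler_sqr ?nnegrE// !real_normK ?num_real//.
  have : b ^+ 2 * A ^+ 2 <= u * v * (S * W) by apply: ler_pM; rewrite ?sqr_ge0.
  have := sqr_ge0 (u * W - S * v); nra.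
nra.
Qed.

(* The Hoelder trick pi_2 <= pi_1: test the summing inequality on the         *)
(* vectors |u (y j)| y j.                                                     *)
Lemma two_summing (V H : normedModType R) (u : {linear V -> H}) (K S : R) m (y : 'I_m -> V) :
  0 <= K -> 0 <= S ->
  (forall n (x : 'I_n -> V), \sum_i `|u (x i)| <= K * sup (weak_sums x)) ->
  (forall c : 'I_m -> R, `|\sum_j c j *: y j| ^+ 2 <= S * \sum_j c j ^+ 2) ->
  \sum_j `|u (y j)| ^+ 2 <= K ^+ 2 * S.
Proof.
move=> K0 S0 uK yS; set L := \sum_j _.
have L0 : 0 <= L by apply: sumr_ge0 => j _; exact: sqr_ge0.
have := uK m (fun j => `|u (y j)| *: y j).
rewrite (_ : \sum_i _ = L); last first.
  by apply: eq_bigr => j _; rewrite linearZ normrZ normr_id -expr2.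
have sL : sup (weak_sums (fun j => `|u (y j)| *: y j)) <= Num.sqrt (S * L).
  apply: ge_sup; first exact: weak_sums_neq0.
  move=> _ [f fB <-].
  (* The signs turn the sum of absolute values into the value of f at one vector. *)
  pose c j := Num.sg (f (y j)) * `|u (y j)|.
  have -> : \sum_j `|f (`|u (y j)| *: y j)| = f (\sum_j c j *: y j).
    rewrite linear_sum; apply: eq_bigr => j _; rewrite !linearZ/= normrZ normr_id.
    by rewrite -[RHS]/(c j * f (y j)) /c mulrAC -normrEsg mulrC.
  apply: le_trans (ler_norm _) _; apply: le_trans (dual_ball_norm _ fB) _.
  rewrite -[leLHS]ger0_norm// -sqrtr_sqr ler_wsqrtr//; apply: le_trans (yS c) _.
  rewrite ler_wpM2l//; apply: ler_sum => j _.
  rewrite /c exprMn -[leRHS]mul1r ler_wpM2r ?sqr_ge0//.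
  by rewrite sqr_sg lern1 leq_b1.
move=> /le_trans/(_ (ler_wpM2l K0 sL)) LK.
have L2 : L ^+ 2 <= K ^+ 2 * (S * L).
  have := sqr_sqrtr (mulr_ge0 S0 L0) => <-; rewrite -exprMn.
  by rewrite lerXn2r ?nnegrE// mulr_ge0// sqrtr_ge0.
have [->|Ln0] := eqVneq L 0; first by rewrite mulr_ge0// sqr_ge0.
have Lp : 0 < L by rewrite lt_neqAle eq_sym Ln0.
by rewrite -(ler_pM2r Lp) -mulrA -expr2.
Qed.

Definition nrm2 n (g : 'I_n -> R) : R := Num.sqrt (\sum_i g i ^+ 2).

Lemma nrm2_sqr n (g : 'I_n -> R) : nrm2 g ^+ 2 = \sum_i g i ^+ 2.
Proof. by rewrite sqr_sqrtr//; apply: sumr_ge0 => i _; exact: sqr_ge0. Qed.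

Lemma nrm2_eq0 n (g : 'I_n -> R) : nrm2 g = 0 -> forall i, g i = 0.
Proof.
move=> g0 i; have := nrm2_sqr g; rewrite g0 expr0n => /esym/eqP.
rewrite psumr_eq0 => [/allP/(_ i (mem_index_enum _))|j _]; last exact: sqr_ge0.
by rewrite sqrf_eq0 => /eqP.
Qed.

Definition tensor_rep n (s : seq (F * ('I_n -> R))) (f : 'I_n -> F) :=
  forall i, f i = \sum_(p <- s) p.2 i *: p.1.

Definition tensor_cost n (s : seq (F * ('I_n -> R))) : R :=
  \sum_(p <- s) `|p.1| * nrm2 p.2.

(* Trace duality: x, viewed as an operator from R^n to X, is nuclear into F   *)
(* with nuclear norm at most the cost of the tensor, hence factors through a  *)
(* Hilbert space (R^n with the form q) as a contraction composed with a       *)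
(* Hilbert-Schmidt operator.                                                  *)
Lemma trace_bound (u : {linear X -> ell2 R nat}) (K : R) n
    (s : seq (F * ('I_n -> R))) (x : 'I_n -> X) :
  0 < K ->
  (forall m (y : 'I_m -> X), \sum_i `|u (y i)| <= K * sup (weak_sums y)) ->
  tensor_rep s (fun i => val (x i)) ->
  \sum_i u (x i) i <= K * tensor_cost s.
Proof.
move=> K0 uK xs; set S := tensor_cost s.
have xsE i : submod_val (x i) = \sum_(p <- s) p.2 i *: p.1 by exact: xs.
have S0 : 0 <= S by apply: sumr_ge0 => p _; rewrite mulr_ge0// sqrtr_ge0.
pose dot (c g : 'I_n -> R) : R := \sum_i c i * g i.
(* The weights [|p.1| / nrm2 p.2] are chosen so that Cauchy-Schwarz gives [|v c| ^+ 2 <= S * q c c],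
   while the trace of q is at most S. *)
pose q (c d : 'I_n -> R) : R :=
  \sum_(p <- s) `|p.1| / nrm2 p.2 * (dot c p.2 * dot d p.2).
have dotP a c d g : dot (a *: c + d) g = a * dot c g + dot d g.
  rewrite /dot mulr_sumr -big_split; apply: eq_bigr => i _ /=.
  by rewrite -[(_ + _) i]/(a * c i + d i) mulrDl mulrA.
have qC c d : q c d = q d c by apply: eq_bigr => p _; rewrite [dot c _ * _]mulrC.
have qP a c d e : q (a *: c + d) e = a * q c e + q d e.
  rewrite /q mulr_sumr -big_split; apply: eq_bigr => p _ /=; rewrite dotP; ring.
have q0 c : 0 <= q c c.
  by apply: sumr_ge0 => p _; rewrite mulr_ge0 ?divr_ge0 ?sqrtr_ge0// -expr2 sqr_ge0.
pose v (c : 'I_n -> R) : X := \sum_i c i *: x i.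
have vl a c d : v (a *: c + d) = a *: v c + v d.
  rewrite /v scaler_sumr -big_split; apply: eq_bigr => i _ /=.
  by rewrite -[(_ + _) i]/(a * c i + d i) scalerDl scalerA.
have vq c : `|v c| ^+ 2 <= S * q c c.
  have -> : `|v c| = `|\sum_(p <- s) dot c p.2 *: p.1|.
    rewrite -[LHS]/`|val (v c)| linear_sum; congr `|_|.
    under eq_bigr => i _ do rewrite linearZ/= xsE scaler_sumr.
    rewrite exchange_big; apply: eq_bigr => p _ /=.
    by rewrite scaler_suml; apply: eq_bigr => i _; rewrite scalerA.
  apply: (@le_trans _ _ ((\sum_(p <- s) `|dot c p.2 *: p.1|) ^+ 2)).
    by rewrite lerXn2r ?nnegrE ?sumr_ge0// ler_norm_sum.
  apply: sum_cauchy_schwarz => p.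
  - by rewrite mulr_ge0// sqrtr_ge0.
  - by rewrite mulr_ge0 ?divr_ge0 ?sqrtr_ge0// -expr2 sqr_ge0.
  - rewrite normrZ exprMn real_normK ?num_real//.
    have [g0|g0] := eqVneq (nrm2 p.2) 0; last first.
      by rewrite le_eqVlt; apply/orP; left; apply/eqP; field.
    rewrite /dot big1 ?expr0n ?mul0r ?mulr0// => i _.
    by rewrite (nrm2_eq0 g0) mulr0.
pose e i : 'I_n -> R := fun k => (k == i)%:R.
have ve i : v (e i) = x i.
  rewrite /v (bigD1 i)//= /e eqxx scale1r big1 ?addr0// => k ki.
  by rewrite (negPf ki) scale0r.
have dote i g : dot (e i) g = g i.
  rewrite /dot (bigD1 i)//= /e eqxx mul1r big1 ?addr0// => k ki.
  by rewrite (negPf ki) mul0r.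
have [m [b [bO bres]]] := gram_schmidt qC qP q0 [seq e i | i <- enum 'I_n].
have v_sum (c : 'I_m -> R) : v (\sum_j c j *: b j) = \sum_j c j *: v (b j).
  elim/big_rec2: _ => [|j y1 y2 _ <-]; last by rewrite vl.
  by rewrite /v big1// => i _; rewrite scale0r.
(* The residual of [e i] is a null vector of q, and v kills null vectors by [vq]. *)
have xE i : x i = \sum_j q (e i) (b j) *: v (b j).
  have : `|v (residual q b (e i))| ^+ 2 <= 0.
    apply: le_trans (vq _) _; rewrite bres ?mulr0//.
    by apply: map_f; rewrite mem_enum.
  rewrite le_eqVlt ltNge sqr_ge0 orbF sqrf_eq0 normr_eq0.
  rewrite /residual addrC -scaleN1r vl v_sum ve scaleN1r addrC subr_eq0.
  by move=> /eqP.
have uvb : \sum_j `|u (v (b j))| ^+ 2 <= K ^+ 2 * S.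
  apply: two_summing => // [|c]; first exact: ltW.
  by rewrite -v_sum (le_trans (vq _))// orthonormal_sqr.
have qb : \sum_i \sum_j q (e i) (b j) ^+ 2 <= S.
  apply: (@le_trans _ _ (\sum_i q (e i) (e i))).
    by apply: ler_sum => i _; exact: bessel.
  rewrite /q exchange_big/=; apply: ler_sum => p _.
  rewrite -mulr_sumr; under eq_bigr do rewrite !dote -expr2.
  rewrite -nrm2_sqr; have [->|g0] := eqVneq (nrm2 p.2) 0.
    by rewrite expr0n !mulr0.
  by rewrite expr2 mulrA divfK.
have uxE i : u (x i) i = \sum_j q (e i) (b j) * u (v (b j)) i.
  rewrite [in LHS]xE linear_sum/=.
  under [in RHS]eq_bigr do rewrite -[_ * _]/((q (e i) (b _) *: u (v (b _))) i) -linearZ.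
  exact: (@big_morph _ _ (fun h : ell2 R nat => h i) 0 +%R).
(* The weights of the arithmetic-geometric mean balance the two Hilbert-Schmidt bounds S and
   [K ^+ 2 * S] into K * S. *)
apply: (@le_trans _ _ (\sum_i \sum_j (K / 2 * q (e i) (b j) ^+ 2 +
    (2 * K)^-1 * u (v (b j)) i ^+ 2))).
  apply: ler_sum => i _; rewrite uxE; apply: ler_sum => j _.
  rewrite -subr_ge0 (_ : _ - _ =
    (K * q (e i) (b j) - u (v (b j)) i) ^+ 2 / (2 * K)); last by field; rewrite gt_eqF.
  by rewrite divr_ge0 ?sqr_ge0// mulr_ge0// ltW.
under eq_bigr do rewrite big_split/= -!mulr_sumr.
rewrite big_split/= -!mulr_sumr (_ : K * S = K / 2 * S + (2 * K)^-1 * (K ^+ 2 * S)); last first.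
  by field; rewrite gt_eqF.
apply: lerD; first by rewrite ler_pM2l// divr_gt0.
rewrite ler_pM2l ?invr_gt0 ?mulr_gt0//; apply: le_trans uvb.
rewrite exchange_big/=; apply: ler_sum => j _.
rewrite -(big_map val predT (fun i => u (v (b j)) i ^+ 2)).
by apply: ell2_norm_sum; rewrite map_inj_uniq ?index_enum_uniq//; exact: val_inj.
Qed.

Lemma ell2_ord_mem n (g : 'I_n -> R) : g \in @ell2_pred R 'I_n.
Proof.
rewrite inE; apply: le_lt_trans (ltry (\sum_i g i ^+ 2)); apply/sqsum_leP => s us.
apply: ler_sum_subset => //; first exact: index_enum_uniq.
  by move=> i _; exact: mem_index_enum.
by move=> i; exact: sqr_ge0.
Qed.

(** On n-tuples in F, viewed as tensors with R^n, p is K times the projective norm. By [trace_bound]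
    it dominates the trace of u on tuples in the kernel, and the values of the Hahn-Banach extension
    at f tensored with the unit vectors are the coordinates of w f. *)
Lemma extends_of_summing (u : {linear X -> ell2 R nat}) :
  absolutely_summing u -> exists M, extends u M.
Proof.
move=> [K0 uK0]; pose K := `|K0| + 1; have K_gt0 : 0 < K by rewrite ltr_wpDl.
have uK n (x : 'I_n -> X) : \sum_i `|u (x i)| <= K * sup (weak_sums x).
  apply: le_trans (uK0 n x) _; apply: ler_wpM2r.
    have [y [f fB fy]] := weak_sums_neq0 x; apply: (@le_trans _ _ y).
      by rewrite -fy sumr_ge0.
    by apply: (ub_le_sup (weak_sums_ub x)); exists f.
  by rewrite (le_trans (ler_norm _))// lerDl.
exists K; apply: extends_limit => [|n']; first exact: ltW.
set n := n'.+1.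
have [U Uu] := algebraic_extension u.
pose costs (f : 'I_n -> F) := [set K * tensor_cost s | s in [set s | tensor_rep s f]].
have cost0 s : 0 <= K * @tensor_cost n s.
  apply: mulr_ge0; [exact: ltW|apply: sumr_ge0 => p _].
  by rewrite mulr_ge0// sqrtr_ge0.
have costs_lb f : has_lbound (costs f) by exists 0 => _ [s _ <-].
have costs_neq0 f : costs f !=set0.
  exists (K * tensor_cost [seq (f j, (fun i => (i == j)%:R)) | j <- enum 'I_n]).
  eexists; last reflexivity.
  move=> i; rewrite big_map big_enum (bigD1 i)//= eqxx scale1r big1 ?addr0// => j ji.
  by rewrite eq_sym (negPf ji) scale0r.
pose p f := inf (costs f).
have p_le f s : tensor_rep s f -> p f <= K * tensor_cost s.
  by move=> fs; apply: ge_inf; [exact: costs_lb|exists s].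
have le_p f a : (forall s, tensor_rep s f -> a <= K * tensor_cost s) -> a <= p f.
  by move=> fa; apply: lb_le_inf => // _ [s fs <-]; exact: fa.
have pD f g : p (f + g) <= p f + p g.
  rewrite -lerBlDr; apply: (le_p) => s fs; rewrite lerBlDr -lerBlDl.
  apply: (le_p) => t gt; rewrite lerBlDl -mulrDr.
  rewrite (_ : _ + _ = tensor_cost (s ++ t)); last by rewrite /tensor_cost big_cat.
  by apply: p_le => i; rewrite big_cat -fs -gt.
have pZ_le a f : 0 < a -> p (a *: f) <= a * p f.
  move=> a0; rewrite -ler_pdivrMl//; apply: (le_p) => s fs; rewrite ler_pdivrMl//.
  rewrite mulrCA.
  rewrite (_ : a * _ = tensor_cost [seq (a *: z.1, z.2) | z <- s]); last first.
    rewrite /tensor_cost big_map mulr_sumr; apply: eq_bigr => z _ /=.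
    by rewrite normrZ gtr0_norm// mulrA.
  apply: p_le => i; rewrite big_map -[LHS]/(a *: f i) fs scaler_sumr.
  by apply: eq_bigr => z _ /=; rewrite !scalerA mulrC.
have pZ a f : 0 < a -> p (a *: f) = a * p f.
  move=> a0; apply/eqP; rewrite eq_le pZ_le//= -ler_pdivlMl//.
  by have := pZ_le a^-1 (a *: f); rewrite invr_gt0 scalerK ?gt_eqF//; exact.
pose D := [set f : 'I_n -> F | forall i, Q (f i) = 0].
pose phi (f : 'I_n -> F) : R := \sum_i U (f i) i.
have phiP a f g : phi (a *: f + g) = a * phi f + phi g.
  rewrite /phi mulr_sumr -big_split; apply: eq_bigr => i _ /=.
  by rewrite -[(_ + _) i]/(a *: f i + g i) linearP.
have [||||Phi [PhiD Phip]] := @hahn_banach R ('I_n -> F) p pD pZ D phi.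
- by move=> i; rewrite linear0.
- by move=> a f g Df Dg i; rewrite linearP/= Df Dg scaler0 addr0.
- by move=> a f g _ _; exact: phiP.
- move=> f Df; apply: (le_p) => s fs.
  have [x xf] := choice (fun i => linker_mem (Df i)).
  rewrite /phi; under eq_bigr => i _ do rewrite -xf Uu.
  by apply: trace_bound => // i; rewrite xf; exact: fs.
pose tens (f : F) (g : 'I_n -> R) : 'I_n -> F := fun i => g i *: f.
pose w0 f : ell2 R 'I_n := Ell2 (ell2_ord_mem (fun i => Phi (tens f (fun k => (k == i)%:R)) : R)).
have w0l : linear w0.
  move=> a f g; apply: val_inj; apply/funext => i.
  rewrite -[RHS]/(a * w0 f i + w0 g i) /w0 /=.
  rewrite -[RHS]linearP; congr (Phi _); apply/funext => k.
  rewrite -[RHS]/(a *: ((k == i)%:R *: f) + (k == i)%:R *: g).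
  by rewrite /tens scalerDr !scalerA mulrC.
have [w wE] := linear_pack w0l; exists w; split=> [x i|f]; rewrite wE.
  rewrite /w0 /= PhiD; last first.
    by move=> k; rewrite linearZ/= linker_val scaler0.
  rewrite /phi (bigD1 i)//= /tens eqxx scale1r Uu big1 ?addr0// => k ki.
  by rewrite (negPf ki) scale0r linear0.
(* Evaluating [Phi] at the elementary tensor of f and [w0 f], whose cost is a single product, gives
   the square of the norm. *)
have wg : `|w0 f| ^+ 2 <= K * (`|f| * `|w0 f|).
  have -> : `|w0 f| ^+ 2 = Phi (tens f (w0 f)).
    rewrite ell2_ord_norm -/(nrm2 _) nrm2_sqr.
    rewrite (_ : tens f (w0 f) = \sum_i w0 f i *: tens f (fun k => (k == i)%:R)).
      by rewrite linear_sum; apply: eq_bigr => i _; rewrite linearZ.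
    apply/funext => k; rewrite fct_sumE (bigD1 k)//= big1 ?addr0.
      by rewrite -[RHS]/(w0 f k *: ((k == k)%:R *: f)) eqxx scale1r.
    move=> i ik; rewrite -[LHS]/(w0 f i *: ((k == i)%:R *: f)).
    by rewrite eq_sym (negPf ik) scale0r scaler0.
  apply: le_trans (Phip _) _.
  rewrite (_ : `|f| * _ = tensor_cost [:: (f, w0 f : 'I_n -> R)]).
    by apply: p_le => i; rewrite big_seq1.
  by rewrite /tensor_cost big_seq1 /= ell2_ord_norm.
have [->|wn0] := eqVneq `|w0 f| 0; first by rewrite mulr_ge0// ltW.
have wp : 0 < `|w0 f| by rewrite lt_neqAle eq_sym wn0 normr_ge0.
by rewrite -(ler_pM2r wp) -mulrA -expr2.
Qed.

End ExtendsOfSumming.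

(** * The equivalences, through the extension property *)

Theorem theorem3p1 (R : realType) (E F : completeNormedModType R)
    (Q : {linear F -> E}) :
  L1_space F ->
  continuous Q ->
  (forall e : E, exists x : F, Q x = e) ->
  (GT_space (submod_type (linker Q)) <->
   (forall Y : twisted_sum (ell2 R nat) E, splits Y)) /\
  ((forall Y : twisted_sum (ell2 R nat) E, splits Y) <->
   (ereal_sup [set s : \bar R |
      exists (n : nat) (Y : twisted_sum (ell2 R 'I_n) E),
        (0 < n)%N /\ s = spl Y] < +oo)%E).
Proof.
move=> FL1 Qc Qs; pose X := submod_type (linker Q).
have [C C0 split_ext] := splits_of_extends Qc Qs FL1.
have [c c0 ext_split] := extends_of_splits Qc Qs.
pose ext := forall u : {linear X -> ell2 R nat}, continuous u -> exists M, extends u M.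
have extM (I : choiceType) (u : {linear X -> ell2 R I}) M : extends u M -> extends u `|M|.
  move=> [w [wu wM]]; exists w; split=> // f.
  by apply: le_trans (wM f) _; rewrite ler_wpM2r// ler_norm.
have GT_ext : GT_space X <-> ext.
  split=> [gt u uc|e u uc]; first exact/extends_of_summing/gt.
  by have [M] := e u uc; exact: summing_of_extends.
have splits_ext : (forall Y : twisted_sum (ell2 R nat) E, splits Y) <-> ext.
  split=> [sp u uc|e Y]; last first.
    have [u [uC uext]] := split_ext _ Y.
    have [M /extM uM] := e u (bounded_linear_cont uC).
    by have [v vs _] := uext `|M| (normr_ge0 M) uM; exists v.
  have [a a0 ua] := linear_continuous_bound uc.
  have ca0 : 0 < a / c by exact: divr_gt0.
  (* [ext_split] accepts operators bounded by c only, so u is scaled down by a / c and the extension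
     scaled back. *)
  have [x|Y YP] := ext_split _ ((a / c)^-1 \*: u).
    rewrite /= normrZ gtr0_norm ?invr_gt0// ler_pdivrMl//.
    by apply: le_trans (ua x) _; rewrite mulrA divfK ?gt_eqF.
  have [v [vc vs]] := sp Y.
  have [B B0 vB] := linear_continuous_bound vc.
  have [w [wu wM]] := YP v B (ltW B0) vs vB.
  eexists; exists (a / c \*: w); split=> [x|f] /=.
    by rewrite wu /= scalerA divff ?gt_eqF// scale1r.
  rewrite normrZ gtr0_norm//.
  by apply: le_trans (ler_wpM2l (ltW ca0) (wM f)) _; rewrite mulrA.
have spl_ext : ext <-> (ereal_sup [set s : \bar R |
    exists (n : nat) (Y : twisted_sum (ell2 R 'I_n) E),
      (0 < n)%N /\ s = spl Y] < +oo)%E.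
  split=> [/uniform_extends[D D0 uni]|spl_fin u uc].
    pose B := C * (C + C * D).
    have B0 : 0 <= B by rewrite mulr_ge0 ?addr_ge0 ?mulr_ge0 ?ltW.
    apply: le_lt_trans (ltry (Num.sqrt (B ^+ 2 + (1 + B) ^+ 2))).
    apply: ge_ereal_sup => _ [n [Y [_ ->]]].
    have [u [uC uext]] := split_ext _ Y.
    have uD : extends u (C * D).
      apply: extends_scale => // u' u'1; exact: extends_ord u'1.
    have [|v vs vB] := uext _ _ uD; first by rewrite mulr_ge0// ltW.
    exact: spl_le vs vB.
  have [S splS] : exists S : R, forall n (Y : twisted_sum (ell2 R 'I_n.+1) E), (spl Y < S%:E)%E.
    move: spl_fin; set s := ereal_sup _ => s_fin.
    have sub n (Y : twisted_sum (ell2 R 'I_n.+1) E) : (spl Y <= s)%E.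
      by apply: ereal_sup_ubound; exists n.+1, Y.
    (* The added 1 gives the strict inequality which [spl_lt] needs to pick an actual section from
       the infimum. *)
    exists (fine s + 1) => n Y; apply: le_lt_trans (sub n Y) _.
    case: s s_fin {sub} => [r|//|] _ /=; first by rewrite lte_fin ltrDl.
    by rewrite ltNyr.
  have [a a0 ua] := linear_continuous_bound uc.
  have ca0 : 0 < a / c by exact: divr_gt0.
  pose M := a / c * (opnorm Q + c + `|S| * opnorm Q); exists M.
  apply: extends_limit => [|n].
    apply: mulr_ge0; first exact: ltW.
    by rewrite !addr_ge0 ?mulr_ge0 ?opnorm_ge0// ltW.
  have [P PC PE] := @ell2_pull R 'I_n.+1 nat (fun i => Some (val i))
    (fun i j k => ltac:(by move=> [<-] [/val_inj ->])).
  have [x|Y YP] := ext_split _ ((a / c)^-1 \*: (P \o u)).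
    rewrite /= normrZ gtr0_norm ?invr_gt0// ler_pdivrMl//.
    apply: le_trans (PC _) _; apply: le_trans (ua x) _.
    by rewrite mulrA divfK ?gt_eqF.
  have [v [vc vs] vS] := spl_lt (splS n Y).
  have [z|w [wu wM]] := YP v `|S| (normr_ge0 S) vs.
    by apply: le_trans (vS z) _; rewrite ler_wpM2r// ler_norm.
  exists (a / c \*: w); split=> [x i|f] /=.
    by rewrite wu /= scalerA divff ?gt_eqF// scale1r PE.
  rewrite normrZ gtr0_norm// /M.
  by apply: le_trans (ler_wpM2l (ltW ca0) (wM f)) _; rewrite mulrA.
split; first exact: iff_trans GT_ext (iff_sym splits_ext).
exact: iff_trans splits_ext spl_ext.
Qed.
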